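(* Let $A_\Gamma$ be an irreducible finite-type Artin group and let $\{P_i\}$ be a collection of vertices spanning a simplex in $C_{parab}(A_\Gamma)$. Then there is a positive element $g\in A_\Gamma$ such that $g^{-1}P_ig$ is a standard parabolic subgroup for every $P_i$.
   Context: A finite-type Artin group $A_\Gamma$ has a finite generating set $V(\Gamma)$ (the Artin generators) and, for each pair of distinct generators $s,t$, one relation $sts\cdots = tst\cdots$ with $m_{st}=m_{ts}\ge 2$ letters on each side, such that the associated Coxeter group (obtained by adding $s^2=1$ for all generators $s$) is finite. The defining graph $\Gamma$ has vertex set $V(\Gamma)$, with $s,t$ adjacent iff $m_{st}\ge 3$. $A_\Gamma$ is irreducible if $\Gamma$ is connected. An element is positive if it lies in the submonoid generated by the Artin generators. For $X\subseteq V(\Gamma)$, $A_X=\langle X\rangle$ is a standard parabolic subgroup; a parabolic subgroup is any conjugate $gA_Xg^{-1}$, $g\in A_\Gamma$; it is irreducible if the induced subgraph of $\Gamma$ on $X$ is (nonempty and) connected. $\Delta_X$ is the least common multiple of the elements of $X$ in the positive monoid. $\Delta_X^2$ is always central in $A_X$; $z_X$ denotes $\Delta_X$ if it is central in $A_X$ and $\Delta_X^2$ otherwise. For $P=gA_Xg^{-1}$, $z_P=gz_Xg^{-1}$ (well-defined). $C_{parab}(A_\Gamma)$ is the simplicial complex whose vertices are the irreducible proper parabolic subgroups of $A_\Gamma$, where vertices $P_1,\dots,P_n$ span a simplex iff the $z_{P_i}$ pairwise commute. *)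

(* Defs.v *)
From HB Require Import structures.
From mathcomp Require Import all_boot all_classical.

Set Implicit Arguments.
Unset Strict Implicit.
Unset Printing Implicit Defensive.

Local Open Scope classical_set_scope.
Local Open Scope quotient_scope.
Local Open Scope group_scope.

(* The letter (s, false) stands for s, and (s, true) for its formal inverse. *)
Definition word (V : Type) := seq (V * bool).

Section Presentation.
Variables (V : choiceType) (R : word V -> word V -> Prop).

(* The smallest congruence on words containing R and free cancellation. *)
Inductive pres_eq : word V -> word V -> Prop :=
| pres_rel u v : R u v -> pres_eq u v
| pres_cancel s b : pres_eq [:: (s, b); (s, ~~ b)] [::]
| pres_refl u : pres_eq u u
| pres_sym u v : pres_eq u v -> pres_eq v u
| pres_trans u v w : pres_eq u v -> pres_eq v w -> pres_eq u w
| pres_cat u u' v v' :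
    pres_eq u u' -> pres_eq v v' -> pres_eq (u ++ v) (u' ++ v').

Definition pres_eqb (u v : word V) : bool := `[< pres_eq u v >].

Lemma pres_eqb_refl : reflexive pres_eqb.
Proof. by move=> u; apply/asboolP; apply: pres_refl. Qed.

Lemma pres_eqb_sym : symmetric pres_eqb.
Proof.
by move=> u v; apply/idP/idP => /asboolP uv; apply/asboolP; apply: pres_sym.
Qed.

Lemma pres_eqb_trans : transitive pres_eqb.
Proof.
by move=> v u w /asboolP uv /asboolP vw; apply/asboolP; apply: pres_trans vw.
Qed.

Canonical pres_equiv :=
  EquivRel pres_eqb pres_eqb_refl pres_eqb_sym pres_eqb_trans.

Definition presented_group : Type := {eq_quot pres_equiv}.
HB.instance Definition _ := Choice.on presented_group.
HB.instance Definition _ := EqQuotient.on presented_group.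

Definition pres_class (u : word V) : presented_group := \pi_presented_group u.

Lemma pres_classP u v : pres_class u = pres_class v <-> pres_eq u v.
Proof. by split=> [/eqmodP/asboolP|uv]; last by apply/eqmodP/asboolP. Qed.

Lemma pres_reprK (x : presented_group) : pres_class (repr x) = x.
Proof. exact: reprK. Qed.

Lemma pres_repr_class u : pres_eq (repr (pres_class u)) u.
Proof. by apply/pres_classP; rewrite pres_reprK. Qed.

Definition word_inv (u : word V) : word V :=
  [seq (a.1, ~~ a.2) | a <- rev u].

Lemma word_inv_cat u v : word_inv (u ++ v) = word_inv v ++ word_inv u.
Proof. by rewrite /word_inv rev_cat map_cat. Qed.

Lemma word_invK : involutive word_inv.
Proof.
move=> u; rewrite /word_inv -map_rev revK -map_comp -[RHS]map_id.
by apply: eq_map => -[s b] /=; rewrite negbK.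
Qed.

Lemma word_mulVw u : pres_eq (word_inv u ++ u) [::].
Proof.
elim: u => [|[s b] u IHu]; first exact: pres_refl.
rewrite -cat1s word_inv_cat -catA [X in _ ++ X]catA.
apply: pres_trans IHu; apply: pres_cat; first exact: pres_refl.
rewrite -[X in pres_eq _ X]cat0s; apply: pres_cat; last exact: pres_refl.
by have := pres_cancel s (~~ b); rewrite negbK.
Qed.

Lemma word_mulwV u : pres_eq (u ++ word_inv u) [::].
Proof. by rewrite -{1}[u]word_invK; apply: word_mulVw. Qed.

Lemma word_inv_eq u v : pres_eq u v -> pres_eq (word_inv u) (word_inv v).
Proof.
move=> uv; apply: (@pres_trans _ (word_inv u ++ (v ++ word_inv v))).
  rewrite -[X in pres_eq X _]cats0; apply: pres_cat; first exact: pres_refl.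
  by apply: pres_sym; apply: word_mulwV.
rewrite catA -[X in pres_eq _ X]cat0s; apply: pres_cat; last exact: pres_refl.
apply: pres_trans (word_mulVw u); apply: pres_cat; first exact: pres_refl.
exact: pres_sym.
Qed.

Definition pres_one : presented_group := pres_class [::].
Definition pres_mul (x y : presented_group) : presented_group :=
  pres_class (repr x ++ repr y).
Definition pres_inv (x : presented_group) : presented_group :=
  pres_class (word_inv (repr x)).

Lemma pres_mulE u v :
  pres_mul (pres_class u) (pres_class v) = pres_class (u ++ v).
Proof. by apply/pres_classP; apply: pres_cat; apply: pres_repr_class. Qed.

Lemma pres_invE u : pres_inv (pres_class u) = pres_class (word_inv u).
Proof. by apply/pres_classP/word_inv_eq/pres_repr_class. Qed.

Lemma pres_mulA : associative pres_mul.
Proof.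
move=> x y z; rewrite -[x]pres_reprK -[y]pres_reprK -[z]pres_reprK.
by rewrite !pres_mulE catA.
Qed.

Lemma pres_mul1 : left_id pres_one pres_mul.
Proof. by move=> x; rewrite -[x]pres_reprK pres_mulE. Qed.

Lemma pres_mulr1 : right_id pres_one pres_mul.
Proof. by move=> x; rewrite -[x]pres_reprK pres_mulE cats0. Qed.

Lemma pres_mulV : left_inverse pres_one pres_inv pres_mul.
Proof.
move=> x; rewrite -[x]pres_reprK pres_invE pres_mulE.
by apply/pres_classP/word_mulVw.
Qed.

Lemma pres_mulrV : right_inverse pres_one pres_inv pres_mul.
Proof.
move=> x; rewrite -[x]pres_reprK pres_invE pres_mulE.
by apply/pres_classP/word_mulwV.
Qed.

HB.instance Definition _ := isGroup.Build presented_group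
  pres_mulA pres_mul1 pres_mulr1 pres_mulV pres_mulrV.

Definition pres_gen (s : V) : presented_group := pres_class [:: (s, false)].

End Presentation.

Section Closure.
Variable G : groupType.

Definition gen_subgroup (B : set G) : set G :=
  smallest (fun H : set G => group_closed [in H]) B.

Definition gen_submonoid (B : set G) : set G :=
  smallest (fun H : set G => monoid_closed [in H]) B.

(* g A g^-1; the library's [x ^ g] is [g^-1 * (x * g)]. *)
Definition conj_set (g : G) (A : set G) : set G := [set g * x * g^-1 | x in A].

End Closure.

(* All labels are finite, as they are in finite type; the diagonal is unused. *)
Record artin_data (V : finType) := ArtinData {
  m_lab :> V -> V -> nat;
  m_lab_sym : forall s t, m_lab s t = m_lab t s;
  m_lab_ge2 : forall s t, s != t -> 2 <= m_lab s t
}.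

Section Artin.
Variables (V : finType) (M : artin_data V).

Fixpoint alternating (n : nat) (s t : V) : word V :=
  if n is n'.+1 then (s, false) :: alternating n' t s else [::].

Definition artin_rel (u v : word V) : Prop :=
  exists s t, [/\ s != t, u = alternating (M s t) s t
                        & v = alternating (M s t) t s].

Definition coxeter_rel (u v : word V) : Prop :=
  artin_rel u v \/ exists s, u = [:: (s, false); (s, false)] /\ v = [::].

Definition artin_group := presented_group artin_rel.

Definition coxeter_group := presented_group coxeter_rel.

Definition finite_type : Prop := finite_set [set: coxeter_group].

Definition artin_gen (s : V) : artin_group := pres_gen artin_rel s.

Definition graph_adj (X : {set V}) : rel V :=
  [rel s t | [&& s \in X, t \in X, s != t & 3 <= M s t]].

Definition graph_connected (X : {set V}) : Prop :=
  forall s t, s \in X -> t \in X -> connect (graph_adj X) s t.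

Definition irreducible : Prop := graph_connected [set: V]%SET.

Definition positive : set artin_group := gen_submonoid (range artin_gen).

Definition std_parabolic (X : {set V}) : set artin_group :=
  gen_subgroup [set artin_gen s | s in [set` X]].

Definition is_std_parabolic (P : set artin_group) : Prop :=
  exists X, P = std_parabolic X.

Definition is_irreducible_parabolic (P : set artin_group) : Prop :=
  exists (g : artin_group) (X : {set V}), [/\ X != finset.set0, graph_connected X
                & P = conj_set g (std_parabolic X)].

Definition left_divides (a b : artin_group) : Prop :=
  exists2 c, positive c & b = a * c.

(* Least common multiple in the positive monoid for the prefix order. It is
   unique because the positive monoid has no non-trivial invertible elements. *)
Definition is_lcm (X : {set V}) (d : artin_group) : Prop :=
  [/\ positive d,
      forall s, s \in X -> left_divides (artin_gen s) d
    & forall e, positive e ->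
        (forall s, s \in X -> left_divides (artin_gen s) e) ->
        left_divides d e].

(* [xget 1] selects the element with the given property; the default value 1 is
   irrelevant in finite type, where such an element exists. *)
Definition Delta (X : {set V}) : artin_group := xget 1 [set d | is_lcm X d].

Definition Delta_central (X : {set V}) : Prop :=
  forall x, std_parabolic X x -> commute (Delta X) x.

Definition z_std (X : {set V}) : artin_group :=
  if `[< Delta_central X >] then Delta X else Delta X ^+ 2.

(* In finite type g z_X g^-1 depends only on the parabolic subgroup g A_X g^-1,
   so the element selected here does not depend on any choice. *)
Definition z_parabolic (P : set artin_group) : artin_group :=
  xget 1 [set z | exists (g : artin_group) (X : {set V}),
    P = conj_set g (std_parabolic X) /\ z = g * z_std X * g^-1].

Definition Cparab_vertex (P : set artin_group) : Prop :=
  is_irreducible_parabolic P /\ P <> setT.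

Definition Cparab_simplex (S : set (set artin_group)) : Prop :=
  [/\ finite_set S, S !=set0, S `<=` Cparab_vertex
    & forall P Q, S P -> S Q -> commute (z_parabolic P) (z_parabolic Q)].

End Artin.

(* Main.v *)
(* Let [C] be the set of positive [c] conjugating a given element [a] into the
   positive monoid. If [a] is conjugate to a positive element, [C] is nonempty
   and stable under greatest common divisors, so it has a least element [c];
   when a positive [b] commutes with [a], [b c] lies in [C] too, hence [c]
   divides [b c] and [c] keeps [b] positive. Applied successively to the
   commuting [z_P], this gives one positive [g] making all [g^-1 z_P g] positive.

   It remains to see that if [g] is positive and [g^-1 Delta_X^2 g] is positive,
   then [g^-1 A_X g] is standard. Generators of [X] dividing [g] commute with
   [Delta_X^2] and normalize [A_X], so they can be removed; otherwise the
   greatest simple divisor [w] of [g] has no left descent in [X], and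
   [w <= Delta_X^2 w] forces [w <= Delta_X w] in the Coxeter group, hence
   [w^-1 X w] consists of generators and one concludes by induction on [g].

   The Garside structure comes from the Coxeter group [W]: the exchange property
   follows from counting reflections crossed by a word, the order of [s t] is
   found in Tits' representation, and joins in the weak order are built from the
   joins of two covers. The positive monoid acts on pairs (simple element,
   word), which yields greedy heads, cancellation of [Delta], and the embedding
   of the positive monoid in the Artin group. *)
Require Import Defs.
From HB Require Import structures.
From mathcomp Require Import all_boot all_classical.
From mathcomp Require Import all_algebra all_field ring zify.
From Corelib Require Setoid.

Set Implicit Arguments.
Unset Strict Implicit.
Unset Printing Implicit Defensive.

(** * The order of a product of two generators *)

Section Alternating.
Variable V : Type.

Fixpoint alt (n : nat) (s t : V) : seq V :=
  if n is n'.+1 then s :: alt n' t s else [::].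

Lemma size_alt n s t : size (alt n s t) = n.
Proof. by elim: n s t => //= n IHn s t; rewrite IHn. Qed.

Definition pos (u : seq V) : word V := [seq (s, false) | s <- u].

Lemma pos_cat u v : pos (u ++ v) = pos u ++ pos v.
Proof. exact: map_cat. Qed.

Lemma letters_pos u : [seq a.1 | a <- pos u] = u.
Proof. by elim: u => //= s u ->. Qed.

End Alternating.

Lemma pos_alt (V : finType) n (s t : V) : pos (alt n s t) = alternating n s t.
Proof. by elim: n s t => //= n IHn s t; rewrite -IHn. Qed.

Section TitsRepresentation.
Variables (V : finType) (M : artin_data V).
Import GRing.Theory Num.Theory.
Local Open Scope ring_scope.

Definition root_of_unity (n : nat) : algC :=
  if n is n'.+1 then sval (C_prim_root_exists (ltn0Sn n')) else 1.

Lemma root_of_unityP n : (0 < n)%N -> n.-primitive_root (root_of_unity n).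
Proof. by case: n => // n _; rewrite /root_of_unity; case: C_prim_root_exists. Qed.

Definition tits_q s t := root_of_unity (2 * M s t).
(* [q + q^-1] plays the part of [2 cos (pi / m)]. *)
Definition tits_c s t := tits_q s t + (tits_q s t)^-1.

(** The dual of Tits' geometric representation: [f] gives the values of a linear form on the simple
    roots, and [s] acts as a reflection. *)
Definition tits_act (s : V) (f : V -> algC) : V -> algC :=
  fun r => if r == s then - f s else f r + tits_c s r * f s.

Definition tits_word (u : word V) (f : V -> algC) : V -> algC :=
  foldr (fun a => tits_act a.1) f u.

Lemma tits_word_cat u v f : tits_word (u ++ v) f = tits_word u (tits_word v f).
Proof. exact: foldr_cat. Qed.

Lemma tits_actK s : involutive (tits_act s).
Proof.
move=> f; apply/funext => r; rewrite /tits_act eqxx.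
by case: eqVneq => [->|_]; rewrite ?opprK // mulrN addrK.
Qed.

Section Dihedral.
Variables (s t : V) (st : s != t).
Let q := tits_q s t.

Lemma tits_q_prim : (2 * M s t).-primitive_root q.
Proof. by apply: root_of_unityP; have := m_lab_ge2 M st; lia. Qed.

Lemma tits_q_sym : tits_q t s = q.
Proof. by rewrite /q /tits_q m_lab_sym. Qed.

Lemma tits_q_neq0 : q != 0.
Proof. by rewrite (prim_root_eq0 tits_q_prim); have := m_lab_ge2 M st; lia. Qed.

Lemma tits_q2 : 1 - q ^+ 2 != 0.
Proof.
rewrite subr_eq0 eq_sym -(prim_order_dvd tits_q_prim); apply/negP => /dvdn_leq.
by have := m_lab_ge2 M st; lia.
Qed.

(** Each of the two reflections swaps [U] and [U'] up to a factor [q] or [q^-1], so alternating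
    words act on them by powers of [q]. *)
Let U (f : V -> algC) := f s + q * f t.
Let U' (f : V -> algC) := q * f s + f t.

Lemma tits_act_s f :
  (U (tits_act s f) = q * U' f) * (U' (tits_act s f) = q^-1 * U f).
Proof.
have q0 := tits_q_neq0.
rewrite /U /U' /tits_act eqxx eq_sym (negbTE st) /tits_c -/q.
by split; field.
Qed.

Lemma tits_act_t f :
  (U' (tits_act t f) = q * U f) * (U (tits_act t f) = q^-1 * U' f).
Proof.
have q0 := tits_q_neq0.
rewrite /U /U' /tits_act eqxx (negbTE st) /tits_c tits_q_sym -/q.
by split; field.
Qed.

Lemma tits_alt k f :
  [/\ U (tits_word (alternating k s t) f) = q ^+ k * (if odd k then U' f else U f),
      U' (tits_word (alternating k s t) f) = q ^- k * (if odd k then U f else U' f),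
      U' (tits_word (alternating k t s) f) = q ^+ k * (if odd k then U f else U' f)
    & U (tits_word (alternating k t s) f) = q ^- k * (if odd k then U' f else U f)].
Proof.
elim: k => [|k [IH1 IH2 IH3 IH4]]; first by rewrite /= invr1 !mul1r.
rewrite /= !tits_act_s !tits_act_t IH1 IH2 IH3 IH4 !exprS !invfM.
by case: (odd k); rewrite /= !mulrA.
Qed.

(** Comparing [U] after both words gives [q ^+ k = q ^- k], while [q] has order [2 * M s t]. *)
Lemma tits_alt_dvd k :
  tits_word (alternating k s t) =1 tits_word (alternating k t s) -> (M s t %| k)%N.
Proof.
(* A vector on which neither [U] nor [U'] vanishes. *)
pose f r : algC := if r == s then 1 else 0.
move=> /(_ f) eqf; have [E1 _ _ E2] := tits_alt k f.
move: E1; rewrite eqf {}E2.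
have -> : U f = 1 by rewrite /U /f eqxx eq_sym (negbTE st) mulr0 addr0.
have -> : U' f = q by rewrite /U' /f eqxx eq_sym (negbTE st) mulr1 addr0.
have q0 := tits_q_neq0.
have qk0 : q ^+ k != 0 by rewrite expf_neq0.
have x0 : (if odd k then q else 1) != 0 by case: (odd k); rewrite ?oner_eq0.
move/(mulIf x0)/(congr1 (fun x => x * q ^+ k)); rewrite mulVf // -exprD.
move/esym/eqP. rewrite -(prim_order_dvd tits_q_prim).
by rewrite addnn -mul2n dvdn_pmul2l.
Qed.

(** Since [q ^+ M s t = q ^- M s t], both words act alike on [U] and [U']. As [1 - q ^+ 2] is
    nonzero, this settles the coordinates [s] and [t]; the invariant [J] settles the others. *)
Lemma tits_braid :
  tits_word (alternating (M s t) s t) =1 tits_word (alternating (M s t) t s).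
Proof.
move=> f; set g := tits_word _ f; set h := tits_word _ f.
have q0 := tits_q_neq0; have q2 := tits_q2.
have qm : q ^- M s t = q ^+ M s t.
  apply: (mulIf (expf_neq0 (M s t) q0)).
  rewrite mulVf ?expf_neq0 // -exprD addnn -mul2n.
  by rewrite (prim_expr_order tits_q_prim).
have [E1 E2 E3 E4] := tits_alt (M s t) f.
have EU : U g = U h by rewrite E1 E4 qm.
have EU' : U' g = U' h by rewrite E2 E3 qm.
have Es : g s = h s.
  apply: (mulfI q2).
  have sol x : (1 - q ^+ 2) * x s = U x - q * U' x by rewrite /U /U'; ring.
  by rewrite !sol EU EU'.
have Et : g t = h t by move: EU'; rewrite /U' Es => /addrI.
apply/funext => r; case: (eqVneq r s) => [-> //|rs]; case: (eqVneq r t) => [-> //|rt].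
pose c := tits_c s t; pose a := tits_c s r; pose b := tits_c t r.
(* On the span of [s] and [t] the form is nondegenerate, so [f r] can be
   corrected to a quantity invariant under both reflections. *)
pose l := (2 * a + c * b) / (4 - c ^+ 2); pose n := (2 * b + c * a) / (4 - c ^+ 2).
pose J (x : V -> algC) := x r + l * x s + n * x t.
have c2 : 4 - c ^+ 2 != 0.
  have -> : 4 - c ^+ 2 = - ((1 - q ^+ 2) / q) ^+ 2.
    by rewrite /c /tits_c -/q; field.
  by rewrite oppr_eq0 expf_neq0 // mulf_neq0 // invr_neq0.
have ts : (t == s) = false by rewrite eq_sym (negbTE st).
have Js x : J (tits_act s x) = J x.
  by rewrite /J /tits_act eqxx (negbTE rs) ts -/a -/c /l /n; field.
have Jt x : J (tits_act t x) = J x.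
  rewrite /J /tits_act eqxx (negbTE rt) (negbTE st) -/b.
  have -> : tits_c t s = c by rewrite /tits_c tits_q_sym.
  by rewrite /l /n; field.
have Jw k : (J (tits_word (alternating k s t) f) = J f) *
            (J (tits_word (alternating k t s) f) = J f).
  by elim: k => //= k IHk; rewrite Js Jt !IHk.
have : J g = J h by rewrite !Jw.
by rewrite /J Es Et => /addIr/addIr.
Qed.

End Dihedral.

Lemma tits_word_eq u v :
  pres_eq (coxeter_rel M) u v -> tits_word u = tits_word v.
Proof.
elim=> {u v} [u v [[s [t [st -> ->]]]|[s [-> ->]]]|s b|//|//|u v w _ -> _ -> //|].
- by apply/funext/tits_braid.
- by apply/funext => f /=; rewrite tits_actK.
- by apply/funext => f /=; rewrite tits_actK.
- by move=> u u' v v' _ Eu _ Ev; apply/funext => f; rewrite !tits_word_cat Eu Ev.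
Qed.

Lemma coxeter_alt_dvd s t k : s != t ->
  pres_eq (coxeter_rel M) (alternating k s t) (alternating k t s) ->
  (M s t %| k)%N.
Proof. by move=> st /tits_word_eq E; apply: tits_alt_dvd => // f; rewrite E. Qed.

End TitsRepresentation.

(** * The exchange property *)

Local Open Scope group_scope.

Section CoxeterGroup.
Variables (V : finType) (M : artin_data V).
Local Notation W := (coxeter_group M).

Definition cgen (s : V) : W := pres_gen (coxeter_rel M) s.
Definition cword (u : seq V) : W := foldr (fun s w => cgen s * w) 1 u.

Lemma cgen2 s : cgen s * cgen s = 1.
Proof.
rewrite [LHS]pres_mulE; apply/pres_classP; apply: pres_rel; right.
by exists s.
Qed.

Lemma cgenV s : (cgen s)^-1 = cgen s.
Proof. by rewrite -[RHS]mul1g -(mulVg (cgen s)) -mulgA cgen2 mulg1. Qed.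

Lemma cgenK s (w : W) : cgen s * (cgen s * w) = w.
Proof. by rewrite mulgA cgen2 mul1g. Qed.

Lemma cword_cat u v : cword (u ++ v) = cword u * cword v.
Proof. by elim: u => [|s u IHu] /=; rewrite ?mul1g // IHu mulgA. Qed.

Lemma cword_rev u : cword (rev u) = (cword u)^-1.
Proof.
elim: u => [|s u IHu] /=; first by rewrite invg1.
by rewrite rev_cons -cats1 cword_cat IHu /= mulg1 invgM cgenV.
Qed.

Lemma class_cword (u : word V) :
  pres_class (coxeter_rel M) u = cword [seq a.1 | a <- u].
Proof.
elim: u => [|[s b] u IHu] //=; rewrite -cat1s -pres_mulE IHu; congr (_ * _).
case: b => //; rewrite -cgenV; symmetry; exact: pres_invE.
Qed.

Lemma cword_surj (w : W) : exists u, cword u = w.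
Proof. by exists [seq a.1 | a <- repr w]; rewrite -class_cword pres_reprK. Qed.

Lemma cword_alt n s t : cword (alt n s t) = pres_class (coxeter_rel M) (alternating n s t).
Proof. by rewrite class_cword -pos_alt letters_pos. Qed.

Lemma cword_braid s t : s != t -> cword (alt (M s t) s t) = cword (alt (M s t) t s).
Proof.
move=> st; rewrite !cword_alt; apply/pres_classP/pres_rel; left.
by exists s, t.
Qed.

Lemma cword_alt_eq s t k : s != t -> 0 < k ->
  cword (alt k s t) = cword (alt k t s) -> M s t <= k.
Proof.
move=> st k0; rewrite !cword_alt => /pres_classP /(coxeter_alt_dvd st).
exact: dvdn_leq.
Qed.

(* The reflections [s1 .. si .. s1] crossed by the word [s1 .. sk]; the parity
   with which each of them occurs depends only on the group element. *)
Fixpoint crossed (u : seq V) : seq W :=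
  if u is s :: u' then cgen s :: [seq cgen s * r * cgen s | r <- crossed u']
  else [::].

Definition crosses u (r : W) := odd (count_mem r (crossed u)).

Lemma crossed_cat u v :
  crossed (u ++ v) = crossed u ++ [seq cword u * r * (cword u)^-1 | r <- crossed v].
Proof.
elim: u => [|s u IHu] /=.
  by rewrite -[LHS]map_id; apply: eq_map => r; rewrite invg1 mulg1 mul1g.
rewrite IHu map_cat -map_comp; congr (_ :: _ ++ _); apply: eq_map => r /=.
by rewrite invgM cgenV !mulgA.
Qed.

Lemma crosses_cat u v r :
  crosses (u ++ v) r = crosses u r (+) crosses v ((cword u)^-1 * r * cword u).
Proof.
rewrite /crosses crossed_cat count_cat oddD count_map; congr (_ (+) odd _).
apply: eq_count => x /=; apply/eqP/eqP => [<-|->]; rewrite !mulgA.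
  by rewrite mulVg mul1g -mulgA mulVg mulg1.
by rewrite mulgV mul1g -mulgA mulgV mulg1.
Qed.

Lemma crosses_cons s u r :
  crosses (s :: u) r = (cgen s == r) (+) crosses u (cgen s * r * cgen s).
Proof.
rewrite -cat1s crosses_cat /= mulg1 cgenV; congr (_ (+) _).
by rewrite /crosses /= addn0; case: eqP.
Qed.

Lemma cword_alt_comm s t k : cword (alt k s t) = (cgen s * cgen t) ^+ k * cword (alt k t s).
Proof.
elim: k s t => [|k IHk] s t /=; first by rewrite expg0 mul1g.
rewrite IHk !mulgA; congr (_ * _).
rewrite expgSr -!mulgA cgen2 mulg1.
by elim: k {IHk} => [|k IHk]; rewrite ?expg0 ?mulg1 ?mul1g // !expgS -!mulgA IHk !mulgA.
Qed.

Lemma crossed_alt s t k :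
  crossed (alt k s t) = mkseq (fun j => (cgen s * cgen t) ^+ j * cgen s) k.
Proof.
elim: k s t => //= k IHk s t; rewrite /mkseq /= expg0 mul1g IHk; congr (_ :: _).
rewrite (iotaDl 1 0) -!map_comp; apply: eq_map => j /=.
rewrite expgS -!mulgA; congr (_ * _); rewrite !mulgA; congr (_ * _).
elim: j => [|j IHj]; rewrite ?expg0 ?mulg1 ?mul1g //.
by rewrite !expgS -!mulgA IHj.
Qed.

(** As [(cgen s * cgen t) ^+ m = 1], the two alternating words cross the same reflections in
    opposite orders. *)
Lemma crosses_braid s t : s != t ->
  crosses (alt (M s t) s t) =1 crosses (alt (M s t) t s).
Proof.
move=> st r; set m := M s t.
have st1 : (cgen s * cgen t) ^+ m = 1.
  have := cword_alt_comm s t m; rewrite -(cword_braid st) -/m => /esym E.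
  by apply: (mulIg (cword (alt m s t))); rewrite E mul1g.
have tsV : cgen t * cgen s = (cgen s * cgen t)^-1 by rewrite invgM !cgenV.
rewrite /crosses !crossed_alt -[in RHS]count_rev; congr (odd (count _ _)).
apply: (@eq_from_nth _ 1); rewrite ?size_rev !size_mkseq // => i im.
rewrite nth_rev ?size_mkseq // !nth_mkseq //; last by lia.
apply: (mulIg (cgen s)); rewrite -!mulgA tsV cgen2 mulg1 expVgn -invgM -expgS.
apply: (mulgI ((cgen s * cgen t) ^+ (m - i.+1).+1)).
by rewrite mulgV -expgnDr -st1; congr (_ ^+ _); lia.
Qed.

Lemma crosses2 s : crosses [:: s; s] =1 crosses [::].
Proof.
move=> r; rewrite !crosses_cons /crosses /= addbF.
suff -> : (cgen s == cgen s * r * cgen s) = (cgen s == r) by rewrite addbb.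
apply/eqP/eqP => [/(congr1 (fun x => cgen s * x * cgen s))|<-].
  by rewrite !mulgA cgen2 mul1g -!mulgA cgen2 mulg1 mul1g => ->.
by rewrite cgen2 mul1g.
Qed.

Lemma crosses_eq u v : cword u = cword v -> crosses u =1 crosses v.
Proof.
have alt_fst n (s t : V) : [seq a.1 | a <- alternating n s t] = alt n s t.
  by rewrite -pos_alt letters_pos.
have inv x y : pres_eq (coxeter_rel M) x y ->
    crosses [seq a.1 | a <- x] =1 crosses [seq a.1 | a <- y].
  elim=> {x y} [x y [[s [t [st -> ->]]]|[s [-> ->]]]|s b|//|x y _ IH r|x y z _ IH1 _ IH2 r|].
  - by rewrite !alt_fst; apply: crosses_braid.
  - exact: crosses2.
  - exact: crosses2.
  - by rewrite IH.
  - by rewrite IH1.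
  - move=> x x' y y' xx' IH1 yy' IH2 r; rewrite !map_cat !crosses_cat IH1 IH2.
    by rewrite -!class_cword; move/pres_classP: xx' => ->.
move=> E r; rewrite -[u]letters_pos -[v]letters_pos; apply: inv.
by apply/pres_classP; rewrite !class_cword !letters_pos.
Qed.

Lemma crossed_mem u r : r \in crossed u -> exists u1 x u2,
  u = u1 ++ x :: u2 /\ r * cword u1 = cword u1 * cgen x.
Proof.
elim: u r => //= s u IHu r; rewrite inE => /orP[/eqP ->|].
  by exists [::], s, u; rewrite /= mul1g mulg1.
case/mapP => r' /IHu[u1 [x [u2 [-> E]]]] ->; exists (s :: u1), x, u2; split=> //=.
by rewrite -!mulgA (mulgA (cgen s) (cgen s)) cgen2 mul1g E.
Qed.

(** * Length and exchange *)

Definition len (w : W) : nat :=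
  ex_minn (P := fun n => `[< exists2 u, size u = n & cword u = w >])
    (let: ex_intro u uw := cword_surj w in
     ex_intro _ (size u) (asboolT (ex_intro2 _ _ u erefl uw))).

Lemma lenP w : exists2 u, size u = len w & cword u = w.
Proof. by rewrite /len; case: ex_minnP => n /asboolP. Qed.

Lemma len_cword u : len (cword u) <= size u.
Proof. by rewrite /len; case: ex_minnP => n _; apply; apply/asboolP; exists u. Qed.

Definition red (w : W) : seq V := sval (cid2 (lenP w)).

Lemma size_red w : size (red w) = len w.
Proof. by rewrite /red; case: cid2. Qed.

Lemma cword_red w : cword (red w) = w.
Proof. by rewrite /red; case: cid2. Qed.

Definition reduced u := size u == len (cword u).

Lemma red_reduced w : reduced (red w).
Proof. by rewrite /reduced size_red cword_red. Qed.

Lemma len1 : len 1 = 0.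
Proof. by apply/eqP; rewrite -leqn0; apply: (len_cword [::]). Qed.

Lemma len_eq0 w : len w = 0 -> w = 1.
Proof. by rewrite -size_red => /size0nil E; rewrite -[w]cword_red E. Qed.

Lemma red1 : red 1 = [::].
Proof. by apply: size0nil; rewrite size_red len1. Qed.

Lemma lenM v w : len (v * w) <= len v + len w.
Proof.
by have := len_cword (red v ++ red w); rewrite cword_cat !cword_red size_cat !size_red.
Qed.

Lemma lenV w : len w^-1 = len w.
Proof.
have le x : len x^-1 <= len x.
  by have := len_cword (rev (red x)); rewrite cword_rev cword_red size_rev size_red.
by apply/eqP; rewrite eqn_leq le -{1}[w]invgK le.
Qed.

(** If [u] does not cross [cgen s], then [s :: u] does; deleting a letter from a reduced word of
    [cgen s * cword u] then shows that [cword u] is shorter, against the hypothesis. *)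
Lemma exchange s u : len (cgen s * cword u) <= len (cword u) ->
  exists u1 x u2, u = u1 ++ x :: u2 /\ cgen s * cword u1 = cword u1 * cgen x.
Proof.
have del v : crosses v (cgen s) -> exists u1 x u2,
    v = u1 ++ x :: u2 /\ cgen s * cword u1 = cword u1 * cgen x.
  move=> ns; apply: crossed_mem; rewrite -has_pred1 has_count.
  by move: ns; rewrite /crosses; case: count.
have short v : crosses v (cgen s) -> len (cgen s * cword v) < len (cword v).
  rewrite (@crosses_eq v (red (cword v))) ?cword_red // => /del[u1 [x [u2 [E Ex]]]].
  have := len_cword (u1 ++ u2); rewrite -[in ltnRHS]size_red -[X in _ * X]cword_red E.
  by rewrite !cword_cat /= mulgA Ex -mulgA cgenK !size_cat /= addnS ltnS.
move=> le; apply: del; apply: contraT => ns.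
have : crosses (s :: u) (cgen s).
  by rewrite crosses_cons eqxx -mulgA cgen2 mulg1 (negbTE ns).
by move/short; rewrite /= cgenK ltnNge le.
Qed.

Lemma len_cgenM s w :
  len w = (len (cgen s * w)).+1 \/ len (cgen s * w) = (len w).+1.
Proof.
have h u : len u <= (len (cgen s * u)).+1.
  rewrite -{1}[u](cgenK s) (leq_trans (lenM _ _)) // -add1n leq_add2r.
  by have := len_cword [:: s]; rewrite /= mulg1.
have := h w; have := h (cgen s * w); rewrite cgenK.
have [le|] := leqP (len (cgen s * w)) (len w); last by lia.
have [|u1 [x [u2 [E Ex]]]] := @exchange s (red w); rewrite ?cword_red //.
suff : len (cgen s * w) < len w by have := h w; lia.
have -> : cgen s * w = cword u1 * cword u2.
  by rewrite -[w]cword_red E cword_cat /= mulgA Ex -mulgA cgenK.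
rewrite -(size_red w) E size_cat /= addnS ltnS -size_cat -cword_cat.
exact: len_cword.
Qed.

End CoxeterGroup.

(** * The weak order and parabolic cosets *)

Lemma cat_eq_split (T : Type) (u v u1 u2 : seq T) x : u ++ v = u1 ++ x :: u2 ->
  (exists u3, u = u1 ++ x :: u3) \/ (exists2 v1, v = v1 ++ x :: u2 & u1 = u ++ v1).
Proof.
elim: u u1 => [|y u IHu] [|z u1] /=.
- by move=> ->; right; exists [::].
- by move=> ->; right; exists (z :: u1).
- by case=> -> _; left; exists u.
- by case=> -> /IHu[[u3 ->]|[v1 -> ->]]; [left; exists u3 | right; exists v1].
Qed.

(* [lia] sees two different atoms when the same product is reached through
   different paths of the algebraic hierarchy; [set] identifies them. *)
Ltac lia_len :=
  repeat match goal with H : context [len _] |- _ => revert H end;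
  repeat match goal with |- context [@len ?V ?M ?w] =>
    let n := fresh "n" in set n := (@len V M w); clearbody n end;
  lia.

Section LengthFunction.
Variables (V : finType) (M : artin_data V).
Local Notation W := (coxeter_group M).
Local Notation cgen := (cgen M).
Local Notation cword := (cword M).
Implicit Types (v w x y z : W) (X : {set V}) (s t : V) (u : seq V).

(** [rdm] says that no cancellation occurs in the product; [prefix_of] is then the weak order by
    initial segments. *)
Definition rdm v w := len (v * w) == len v + len w.
Definition prefix_of v w := rdm v (v^-1 * w).

Lemma rdmP v w : reflect (len (v * w) = len v + len w) (rdm v w).
Proof. exact: eqP. Qed.

Lemma prefixM v w : prefix_of v (v * w) = rdm v w.
Proof. by rewrite /prefix_of mulKg. Qed.

Lemma prefix_ofP v w : reflect (exists2 x, rdm v x & w = v * x) (prefix_of v w).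
Proof.
apply: (iffP idP) => [pvw|[x vx ->]]; last by rewrite prefixM.
by exists (v^-1 * w) => //; rewrite mulVKg.
Qed.

Lemma rdm1l w : rdm 1 w.
Proof. by rewrite /rdm mul1g len1. Qed.

Lemma rdm1r w : rdm w 1.
Proof. by rewrite /rdm mulg1 len1 addn0. Qed.

Lemma rdmV v w : rdm w^-1 v^-1 = rdm v w.
Proof. by rewrite /rdm -invgM !lenV addnC. Qed.

Lemma rdmAl x y z : rdm x y -> rdm (x * y) z -> rdm y z /\ rdm x (y * z).
Proof.
rewrite /rdm -mulgA => /eqP E1 /eqP; rewrite E1 => E2.
have := lenM x (y * z); have := lenM y z; rewrite E2.
by move=> h1 h2; split; apply/eqP; lia_len.
Qed.

Lemma rdmAr x y z : rdm y z -> rdm x (y * z) -> rdm x y /\ rdm (x * y) z.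
Proof.
rewrite /rdm mulgA => /eqP E1 /eqP; rewrite E1 => E2.
have := lenM (x * y) z; have := lenM x y; rewrite E2.
by move=> h1 h2; split; apply/eqP; lia_len.
Qed.

Lemma prefix1 w : prefix_of 1 w.
Proof. exact: rdm1l. Qed.

Lemma prefix_of_refl w : prefix_of w w.
Proof. by rewrite /prefix_of mulVg rdm1r. Qed.

Lemma prefix_of_trans v w x : prefix_of v w -> prefix_of w x -> prefix_of v x.
Proof.
move=> /prefix_ofP[a va ->] /prefix_ofP[b vab ->]; rewrite -mulgA prefixM.
by have [] := rdmAl va vab.
Qed.

Lemma prefix_len v w : prefix_of v w -> len v <= len w.
Proof. by case/prefix_ofP => x /rdmP E ->; rewrite E leq_addr. Qed.

Lemma prefix_eq v w : prefix_of v w -> len w <= len v -> v = w.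
Proof.
case/prefix_ofP => x /rdmP E ->; rewrite E -{2}[len v]addn0 leq_add2l leqn0.
by move=> /eqP/len_eq0 ->; rewrite mulg1.
Qed.

Lemma prefix_anti v w : prefix_of v w -> prefix_of w v -> v = w.
Proof. by move=> vw /prefix_len; apply: prefix_eq. Qed.

Lemma prefix_mul2l x v w : rdm x v -> prefix_of v w -> rdm x w ->
  prefix_of (x * v) (x * w).
Proof.
move=> xv /prefix_ofP[y vy ->] xvy; rewrite mulgA prefixM.
by have [] := rdmAr vy xvy.
Qed.

Lemma prefix_mulI x v w : rdm x v -> rdm x w ->
  prefix_of (x * v) (x * w) -> prefix_of v w.
Proof.
move=> xv xw; case/prefix_ofP => y xvy; rewrite -mulgA => /mulgI ->.
by rewrite prefixM; have [] := rdmAl xv xvy.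
Qed.

Lemma rdm_prefix x v w : rdm x w -> prefix_of v w -> rdm x v.
Proof. by move=> xw /prefix_ofP[y vy E]; rewrite E in xw; have [] := rdmAr vy xw. Qed.

Lemma len_cgen s : len (cgen s) = 1%N.
Proof. by have := len_cgenM s (1 : W); rewrite mulg1 len1 => -[]. Qed.

Lemma rdm_or_prefix s w : rdm (cgen s) w \/ prefix_of (cgen s) w.
Proof.
rewrite /prefix_of /rdm mulVKg cgenV len_cgen add1n.
by case: (len_cgenM s w) => [E|E]; [right; apply/eqP | left; apply/eqP].
Qed.

Lemma prefix_cgen s w : prefix_of (cgen s) w -> len w = (len (cgen s * w)).+1.
Proof. by rewrite /prefix_of /rdm mulVKg cgenV len_cgen => /eqP. Qed.

Lemma reduced_cat u u' :
  reduced M u -> reduced M u' -> rdm (cword u) (cword u') -> reduced M (u ++ u').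
Proof.
by rewrite /reduced => /eqP Eu /eqP Eu' /rdmP E; rewrite cword_cat E size_cat -Eu -Eu'.
Qed.

Lemma reduced_catP u u' :
  reduced M (u ++ u') -> [/\ reduced M u, reduced M u' & rdm (cword u) (cword u')].
Proof.
rewrite /reduced /rdm cword_cat size_cat => /eqP E.
have := len_cword M u; have := len_cword M u'; have := lenM (cword u) (cword u').
by move=> h1 h2 h3; split; apply/eqP; lia_len.
Qed.

Lemma reduced_cons s u :
  reduced M (s :: u) -> reduced M u /\ rdm (cgen s) (cword u).
Proof. by rewrite -cat1s => /reduced_catP[_ ru]; rewrite /= mulg1. Qed.

Lemma prefix_exchange s u : prefix_of (cgen s) (cword u) ->
  exists u1 r u2, u = u1 ++ r :: u2 /\ cgen s * cword u1 = cword u1 * cgen r.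
Proof. by move/prefix_cgen => E; apply: exchange; rewrite E. Qed.

End LengthFunction.

(** * Minimal representatives of parabolic cosets *)

Section ParabolicCosets.
Variables (V : finType) (M : artin_data V).
Local Notation W := (coxeter_group M).
Local Notation cgen := (cgen M).
Local Notation cword := (cword M).
Implicit Types (v w a b e : W) (X : {set V}) (s t : V) (u : seq V).

Definition inW X w := exists2 u, {subset u <= X} & cword u = w.
(** Absence of left descents in [X]; it characterizes the shortest element of the coset of [w]
    ([min_lred], [lred_min]). *)
Definition lred X w := forall s, s \in X -> rdm (cgen s) w.

Lemma inW1 X : inW X 1.
Proof. by exists [::]. Qed.

Lemma inW_gen X s : s \in X -> inW X (cgen s).
Proof.
by move=> sX; exists [:: s]; rewrite /= ?mulg1 // => t; rewrite inE => /eqP ->.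
Qed.

Lemma inWM X v w : inW X v -> inW X w -> inW X (v * w).
Proof.
case=> [u uX <-] [u' u'X <-]; exists (u ++ u'); rewrite ?cword_cat // => s.
by rewrite mem_cat => /orP[/uX|/u'X].
Qed.

Lemma inWV X w : inW X w -> inW X w^-1.
Proof.
by case=> u uX <-; exists (rev u); rewrite ?cword_rev // => s; rewrite mem_rev => /uX.
Qed.

Definition min_word X u :=
  forall u', {subset u' <= X} -> cword u' = cword u -> size u <= size u'.

Lemma min_word_exists X w : inW X w ->
  exists u, [/\ {subset u <= X}, cword u = w & min_word X u].
Proof.
case=> u uX uw.
pose P n := `[< exists u, [/\ {subset u <= X}, cword u = w & size u = n] >].
have exP : exists n, P n by exists (size u); apply/asboolP; exists u.
case: (ex_minnP exP) => n /asboolP[u' [u'X u'w Eu'] minn]; exists u'; split => //.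
by move=> v vX vw; rewrite Eu'; apply: minn; apply/asboolP; exists v; rewrite -u'w.
Qed.

Definition min_in_coset X e := forall b, inW X b -> len e <= len (b * e).

Lemma min_coset_exists X w : exists2 b, inW X b & min_in_coset X (b * w).
Proof.
pose P n := `[< exists2 b, inW X b & len (b * w) = n >].
have exP : exists n, P n.
  by exists (len w); apply/asboolP; exists 1; rewrite ?mul1g //; apply: inW1.
case: (ex_minnP exP) => n /asboolP[b bX Eb] minn; exists b => // b' b'X.
rewrite Eb; apply: minn; apply/asboolP; exists (b' * b); rewrite ?mulgA //.
exact: inWM.
Qed.

(** If a first letter [s] shortened the product, exchange would delete a letter either from [u],
    against the minimality of [s :: u], or from [e], giving a shorter element of its coset. *)
Lemma len_min_word X u e : {subset u <= X} -> min_word X u -> min_in_coset X e ->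
  len (cword u * e) = size u + len e.
Proof.
move=> uX umin emin; elim: u uX umin => [|s u IHu] uX umin; first by rewrite /= mul1g.
have sX : s \in X by rewrite uX // mem_head.
have {}uX : {subset u <= X} by move=> t tu; rewrite uX // inE tu orbT.
have {}IHu : len (cword u * e) = size u + len e.
  apply: IHu => // u' u'X E; have := umin (s :: u'); rewrite /= E ltnS; apply=> //.
  by move=> t; rewrite inE => /orP[/eqP ->|/u'X].
rewrite [cword _]/= -mulgA.
case: (len_cgenM s (cword u * e)) => [E|->]; last by rewrite IHu.
have [|u1 [r [u2 [Eu Er]]]] := @prefix_exchange _ M s (u ++ red e).
  rewrite cword_cat cword_red; apply/prefix_ofP; exists (cgen s * (cword u * e)).
    by rewrite /rdm cgenK len_cgen E.
  by rewrite cgenK.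
case: (cat_eq_split Eu) => [[u3 Eu3]|[v1 Ev1 Eu1]].
  have : size (s :: u) <= size (u1 ++ u3).
    apply: umin.
      move=> t; rewrite mem_cat => /orP[]tu; apply: uX; rewrite Eu3 mem_cat ?tu //.
      by rewrite inE tu !orbT.
    by rewrite /= Eu3 !cword_cat /= mulgA Er -mulgA cgenK.
  by rewrite Eu3 /= !size_cat /= => h; exfalso; lia.
have : len e <= len ((cword u)^-1 * cgen s * cword u * e).
  by apply: emin; apply: inWM; [apply: inWM|]; [apply: inWV| apply: inW_gen|]; try exists u.
have -> : (cword u)^-1 * cgen s * cword u * e = cword (v1 ++ u2).
  rewrite -[e]cword_red Ev1 !cword_cat /= -!mulgA; apply: (mulgI (cword u)); rewrite mulVKg.
  by rewrite !mulgA -[LHS]mulgA -[X in X * _]mulgA -cword_cat -Eu1 Er -!mulgA cgenK.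
move=> h; have := leq_trans h (len_cword _ _); rewrite -(size_red e) Ev1 !size_cat /= addnS.
by rewrite ltnn.
Qed.

Lemma min_in_coset1 X : min_in_coset X 1.
Proof. by move=> b _; rewrite len1. Qed.

Lemma inW_reduced X w : inW X w -> exists u, [/\ {subset u <= X}, cword u = w & reduced M u].
Proof.
move/min_word_exists => [u [uX uw umin]]; exists u; split=> //.
by have := len_min_word uX umin (@min_in_coset1 X); rewrite mulg1 len1 addn0 /reduced => ->.
Qed.

Lemma min_lred X e : min_in_coset X e -> lred X e.
Proof.
move=> emin s sX; case: (rdm_or_prefix s e) => // /prefix_cgen E.
by have := emin _ (inW_gen sX); rewrite E ltnn.
Qed.

(** Otherwise [e] is reached from the shortest element of its coset by a nonempty word in [X], whose
    first letter is a left descent of [e]. *)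
Lemma lred_min X e : lred X e -> min_in_coset X e.
Proof.
move=> eX; have [b bX emin] := min_coset_exists X e.
have [[|s u] [uX Eu umin]] := min_word_exists (inWV bX).
  by move: Eu emin => /= /esym/eqP; rewrite invg_eq1 => /eqP ->; rewrite mul1g.
have sX : s \in X by rewrite uX // mem_head.
have Ee : e = cword (s :: u) * (b * e) by rewrite Eu mulKg.
have E : cgen s * e = cword u * (b * e) by rewrite {1}Ee /= -mulgA cgenK.
have := len_min_word uX umin emin; rewrite -Ee.
have /rdmP := eX s sX; rewrite len_cgen E => E1 E2.
have := lenM (cword u) (b * e); have := len_cword M u; rewrite E1 E2 /=.
by move=> h1 h2; exfalso; lia_len.
Qed.

Lemma rdm_lred X b e : inW X b -> lred X e -> rdm b e.
Proof.
move=> /min_word_exists[u [uX <- umin]] /lred_min emin; apply/rdmP.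
rewrite (len_min_word uX umin emin); congr (_ + _).
by rewrite -[cword u]mulg1 (len_min_word uX umin (@min_in_coset1 X)) len1 addn0.
Qed.

Lemma coset_decomposition X w : exists b e, [/\ inW X b, lred X e & w = b * e].
Proof.
have [b bX emin] := min_coset_exists X w; exists b^-1, (b * w).
by rewrite mulKg; split=> //; [apply: inWV | apply: min_lred].
Qed.

Lemma coset_rep_uniq X b b' e e' : inW X b -> inW X b' -> lred X e -> lred X e' ->
  b * e = b' * e' -> e = e'.
Proof.
move=> bX b'X eX e'X E.
have Ee : e = b^-1 * b' * e' by rewrite -mulgA -E mulKg.
have Ee' : e' = b'^-1 * b * e by rewrite -mulgA E mulKg.
have /rdmP := rdm_lred (inWM (inWV bX) b'X) e'X; rewrite -Ee => E1.
have /rdmP := rdm_lred (inWM (inWV b'X) bX) eX; rewrite -Ee' => E2.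
suff /len_eq0 E0 : len (b^-1 * b') = 0 by rewrite Ee E0 mul1g.
by lia_len.
Qed.

(** Deodhar's lemma: if [s] in [X] is a left descent of [e * cgen r], exchange must delete the final
    [r], since deleting a letter of [e] would make [s] a descent of [e]. *)
Lemma lred_step X e r : lred X e -> rdm e (cgen r) ->
  lred X (e * cgen r) \/ exists2 s, s \in X & cgen s * e = e * cgen r.
Proof.
move=> eX er; have [|/existsNP[s /not_implyP[sX nrs]]] := pselect (lred X (e * cgen r)).
  by left.
right; exists s => //; case: (rdm_or_prefix s (e * cgen r)) => // ps.
have Er : e * cgen r = cword (red e ++ [:: r]) by rewrite cword_cat cword_red /= mulg1.
move: ps; rewrite Er => /prefix_exchange[u1 [x [u2 [Eu Ex]]]].
case: (cat_eq_split Eu) => [[u3 Eu3]|[v1 Ev1 Eu1]].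
  have /rdmP := eX s sX; rewrite len_cgen -{1}[e]cword_red Eu3 cword_cat /= mulgA Ex.
  rewrite -mulgA cgenK -cword_cat => E; have := len_cword M (u1 ++ u3).
  by rewrite E -size_red Eu3 !size_cat /=; lia_len.
case: v1 Ev1 Eu1 => [|? [|? ?]] // [-> _]; rewrite cats0 => Eu1.
by rewrite cword_cat cword_red /= mulg1; move: Ex; rewrite Eu1 cword_red.
Qed.

Lemma rdm_or_shorter e r : rdm e (cgen r) \/ len e = (len (e * cgen r)).+1.
Proof.
rewrite -rdmV cgenV -(lenV e) -(lenV (e * _)) invgM cgenV.
by case: (rdm_or_prefix r e^-1) => [|/prefix_cgen ->]; [left|right].
Qed.

Lemma coset_rep_step X b e r : inW X b -> lred X e -> rdm (b * e) (cgen r) ->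
  exists b' e', [/\ inW X b', lred X e', b * e * cgen r = b' * e' & prefix_of e e'].
Proof.
move=> bX eX ber; have [er|Er] := rdm_or_shorter e r.
  case: (lred_step eX er) => [erX|[s sX Es]].
    by exists b, (e * cgen r); rewrite -mulgA prefixM.
  exists (b * cgen s), e; rewrite -!mulgA Es; split=> //; last exact: prefix_of_refl.
  by apply: inWM => //; apply: inW_gen.
have erX : lred X (e * cgen r).
  move=> s sX; case: (rdm_or_prefix s (e * cgen r)) => // /prefix_cgen E.
  have /rdmP := eX s sX; have := lenM (cgen s * (e * cgen r)) (cgen r).
  by rewrite -!mulgA cgen2 mulg1 !len_cgen => h1 h2; exfalso; lia_len.
move: ber => /rdmP; rewrite -mulgA.
have /rdmP -> := rdm_lred bX erX; have /rdmP -> := rdm_lred bX eX.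
by rewrite len_cgen => h; exfalso; lia_len.
Qed.

(** Along a reduced word leading from [b * e] to [b' * e'], each letter either lengthens the
    representative or is absorbed by the factor in [X]. *)
Lemma coset_rep_mono X b e b' e' : inW X b -> lred X e -> inW X b' -> lred X e' ->
  prefix_of (b * e) (b' * e') -> prefix_of e e'.
Proof.
move=> bX eX b'X e'X /prefix_ofP[x]; rewrite -[x]cword_red.
move: (red x) (red_reduced x) => u.
elim: u b e bX eX => [|r u IHu] b e bX eX.
  rewrite mulg1 => _ _ /esym E; rewrite (coset_rep_uniq bX b'X eX e'X E).
  exact: prefix_of_refl.
move=> /reduced_cons[ru ur] /= beu E; have [ber beru] := rdmAr ur beu.
have [b1 [e1 [b1X e1X E1 ee1]]] := coset_rep_step bX eX ber.
apply: prefix_of_trans ee1 _; apply: IHu b1X e1X ru _ _; rewrite -E1 //.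
by rewrite -mulgA.
Qed.

Lemma prefix_lred X a p e : inW X a -> lred X p -> lred X e ->
  prefix_of p (a * e) -> prefix_of p e.
Proof.
by move=> aX pX eX pae; apply: (coset_rep_mono (inW1 X) pX aX eX); rewrite mul1g.
Qed.

(** Each letter [r] of [u] must pass through [w] as a letter of [X]: otherwise [w * cgen r] is a
    minimal representative and a prefix of [a * w], hence of the shorter [w]. *)
Lemma ribbon X w a u : lred X w -> inW X a -> reduced M u ->
  rdm w (cword u) -> w * cword u = a * w ->
  exists xs, [/\ {subset xs <= X}, cword xs = a, size xs = size u
    & forall x, x \in xs -> exists y, cgen x * w = w * cgen y].
Proof.
move=> wX; elim: u a => [|r u IHu] a aX.
  move=> _ _; rewrite mulg1 -{1}[w]mul1g => /mulIg <-; exists [::].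
  by split=> //.
move=> /reduced_cons[ru ur] /= wu E; have [wr wru] := rdmAr ur wu.
case: (lred_step wX wr) => [wrX|[s sX Es]].
  have : prefix_of (w * cgen r) w.
    by apply: (prefix_lred aX wrX wX); rewrite -E mulgA prefixM.
  by move/prefix_len; move/rdmP: wr => ->; rewrite len_cgen addn1 ltnn.
have E' : w * cword u = (cgen s * a) * w.
  by apply: (mulgI (cgen s)); rewrite !mulgA Es cgen2 mul1g -E mulgA.
have wu' : rdm w (cword u).
  have := lenM (cgen s) (w * cword u); rewrite mulgA Es.
  move/rdmP: wru => ->; move/rdmP: wr => ->; rewrite !len_cgen => h.
  by have := lenM w (cword u) => h'; apply/rdmP; lia_len.
have [xs [xsX Exs sz rib]] := IHu (cgen s * a) (inWM (inW_gen sX) aX) ru wu' E'.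
exists (s :: xs); split.
- by move=> x; rewrite inE => /orP[/eqP ->|/xsX].
- by rewrite /= Exs cgenK.
- by rewrite /= sz.
- by move=> x; rewrite inE => /orP[/eqP ->|/rib //]; exists r.
Qed.

End ParabolicCosets.

(** * Joins, Matsumoto's theorem and longest elements *)

Section LocalJoins.
Variables (T : Type) (A : T -> Prop) (le cov : T -> T -> Prop) (rk : T -> nat).
Variables (N : nat) (x0 : T).
Hypotheses (le_refl : forall x, le x x)
  (le_trans : forall x y z, le x y -> le y z -> le x z).
Hypotheses (Ax0 : A x0) (x0_le : forall x, A x -> le x0 x).
Hypothesis rk_bound : forall x, A x -> rk x <= N.
Hypothesis cov_rk : forall x c, cov x c -> rk x < rk c.
Hypothesis cov_exists : forall x y, A x -> A y -> le x y ->
  x = y \/ exists c, [/\ A c, cov x c & le c y].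
Definition is_join y z j := [/\ A j, le y j, le z j
  & forall b, A b -> le y b -> le z b -> le j b].
Hypothesis cov_join : forall x c1 c2, A c1 -> A c2 -> cov x c1 -> cov x c2 ->
  exists j, is_join c1 c2 j.

(* The join of [y] and [z] above [x] is reached by joining first the two
   covers of [x] below them, then the result with [y] above one cover, and
   finally with [z] above the other. *)
Lemma local_join_exists x y z : A x -> A y -> A z -> le x y -> le x z ->
  exists j, is_join y z j.
Proof.
have [n] := ubnP (N - rk x); elim: n x y z => // n IHn x y z nx Ax Ay Az xy xz.
have [<-|[y1 [Ay1 xy1 y1y]]] := cov_exists Ax Ay xy; first by exists z.
have [<-|[z1 [Az1 xz1 z1z]]] := cov_exists Ax Az xz; first by exists y.
have lt c : A c -> cov x c -> N - rk c < n.
  by move=> Ac xc; have := cov_rk xc; have := rk_bound Ac; lia.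
have [j [Aj y1j z1j jmin]] := cov_join Ay1 Az1 xy1 xz1.
have [p [Ap yp jp pmin]] := IHn y1 y j (lt _ Ay1 xy1) Ay1 Ay Aj y1y y1j.
have z1p := le_trans z1j jp.
have [q [Aq pq zq qmin]] := IHn z1 p z (lt _ Az1 xz1) Az1 Ap Az z1p z1z.
exists q; split=> //; first exact: le_trans yp pq.
move=> b Ab yb zb; apply: qmin => //; apply: pmin => //; apply: jmin => //.
  exact: le_trans yb.
exact: le_trans zb.
Qed.

(** An element of maximal rank has no cover in [A], so its join with any [z] is itself. *)
Lemma local_join_max : exists2 m, A m & forall z, A z -> le z m.
Proof.
pose P n := `[< exists2 m, A m & rk m = n >].
have exP : exists n, P n by exists (rk x0); apply/asboolP; exists x0.
have PN n : P n -> n <= N by move=> /asboolP[m Am <-]; apply: rk_bound.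
case: (ex_maxnP exP PN) => n /asboolP[m Am <-] maxm; exists m => // z Az.
have [j [Aj mj zj _]] := local_join_exists Ax0 Am Az (x0_le Am) (x0_le Az).
have [-> //|[c [Ac mc _]]] := cov_exists Am Aj mj.
have : rk c <= rk m by apply: maxm; apply/asboolP; exists c.
by rewrite leqNgt (cov_rk mc).
Qed.

End LocalJoins.

(** * Braid elements and Matsumoto's theorem *)

Section Braids.
Variables (V : finType) (M : artin_data V).
Local Notation W := (coxeter_group M).
Local Notation cgen := (cgen M).
Local Notation cword := (cword M).
Implicit Types (w x y z : W) (X : {set V}) (s t : V) (u v : seq V).

Definition braid s t : W := cword (alt (M s t) s t).

Lemma braid_sym s t : s != t -> braid t s = braid s t.
Proof. by move=> st; rewrite /braid m_lab_sym cword_braid. Qed.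

Lemma alt_split k s t u1 r u2 : alt k s t = u1 ++ r :: u2 ->
  [/\ u1 = alt (size u1) s t, u1 ++ [:: r] = alt (size u1).+1 s t & size u1 < k].
Proof.
elim: k s t u1 => [|k IHk] s t [|y u1] //=; first by case=> ->.
by case=> -> /IHk[E1 /= E2 ?]; split=> //; congr (_ :: _).
Qed.

(** The exchange would equate two alternating words of length at most [k], against the order of
    [cgen s * cgen t]. *)
Lemma alt_no_exchange s t k u1 r u2 : s != t -> k < M s t ->
  alt k t s = u1 ++ r :: u2 -> cgen s * cword u1 = cword u1 * cgen r -> False.
Proof.
move=> st km /alt_split[E1 E2 lt] E.
suff : M s t <= (size u1).+1 by lia.
apply: (cword_alt_eq st) => //; rewrite -E2 cword_cat /= mulg1 -E; congr (_ * cword _).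
by rewrite -E1.
Qed.

Lemma reduced_alt s t k : s != t -> k <= M s t -> reduced M (alt k s t).
Proof.
elim: k s t => [|k IHk] s t st km; first by rewrite /reduced /= len1.
have ts : t != s by rewrite eq_sym.
have rk : reduced M (alt k t s) by apply: IHk; rewrite 1?m_lab_sym // ltnW.
rewrite [alt _ _ _]/= -cat1s; apply: reduced_cat => //=.
  by rewrite /reduced /= mulg1 len_cgen.
rewrite mulg1; case: (rdm_or_prefix s (cword (alt k t s))) => //.
by move=> /prefix_exchange[u1 [r [u2 [Eu E]]]]; case: (alt_no_exchange st km Eu E).
Qed.

Lemma len_braid s t : s != t -> len (braid s t) = M s t.
Proof. by move=> st; have /eqP <- := reduced_alt st (leqnn _); rewrite size_alt. Qed.

Lemma prefix_gen_braid s t : s != t -> prefix_of (cgen s) (braid s t).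
Proof.
move=> st; have := reduced_alt st (leqnn _); have := m_lab_ge2 M st.
by rewrite /braid; case: (M s t) => //= k _ /reduced_cons[_]; rewrite prefixM.
Qed.

(** Let [w] begin with an alternating word of fewer than [M s t] letters and exchange with the other
    generator: by [alt_no_exchange] the deleted letter lies beyond that word, which thus grows by
    one. *)
Lemma prefix_braid s t w : s != t ->
  prefix_of (cgen s) w -> prefix_of (cgen t) w -> prefix_of (braid s t) w.
Proof.
move=> st sw tw.
have main k : k <= M s t -> forall a b, (a, b) = (s, t) \/ (a, b) = (t, s) ->
    exists2 x, w = cword (alt k a b) * x & len w = (k + len x)%N.
  elim: k => [|k IHk] km a b abst; first by exists w; rewrite ?mul1g.
  have ab : a != b by case: abst => -[-> ->] //; rewrite eq_sym.
  have aw : prefix_of (cgen a) w by case: abst => -[-> _].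
  have kab : k < M a b by case: abst => -[-> ->] //; rewrite m_lab_sym.
  have [|x Ew Elen] := IHk (ltnW km) b a.
    by case: abst => -[-> ->]; [right|left].
  have Ew' : w = cword (alt k b a ++ red x) by rewrite cword_cat cword_red.
  have [] := @prefix_exchange _ M a (alt k b a ++ red x); rewrite -?Ew' //.
  move=> u1 [r [u2 [Eu E]]]; case: (cat_eq_split Eu) => [[u3 Eu3]|[v1 Ev1 Eu1]].
    by case: (alt_no_exchange ab kab Eu3 E).
  have Eaw : cgen a * w = cword (alt k b a) * cword (v1 ++ u2).
    by rewrite Ew' Eu cword_cat /= mulgA E -mulgA cgenK Eu1 !cword_cat mulgA.
  have E2 : w = cword (alt k.+1 a b) * cword (v1 ++ u2) by rewrite /= -mulgA -Eaw cgenK.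
  exists (cword (v1 ++ u2)) => //; apply/eqP; rewrite eqn_leq; apply/andP; split.
    have := lenM (cword (alt k.+1 a b)) (cword (v1 ++ u2)); rewrite -E2.
    by have := len_cword M (alt k.+1 a b); rewrite size_alt => h1 h2; lia_len.
  have := len_cword M (v1 ++ u2); rewrite Elen -(size_red x) Ev1 !size_cat /= => h.
  by lia_len.
have [x -> El] := main _ (leqnn _) s t (or_introl erefl).
by rewrite prefixM /rdm len_braid // -El.
Qed.

Lemma rdm_braid s t w : s != t ->
  rdm w (cgen s) -> rdm w (cgen t) -> rdm w (braid s t).
Proof.
move=> st ws wt; rewrite -rdmV; apply: (@rdm_lred _ _ [set s; t]%SET).
  apply: inWV; exists (alt (M s t) s t) => //.
  move: (M s t) => k; suff h a b : (a, b) = (s, t) \/ (a, b) = (t, s) ->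
      {subset alt k a b <= [set s; t]%SET} by apply: h; left.
  elim: k a b => // k IHk a b abst r; rewrite inE => /orP[/eqP ->|].
    by case: abst => -[-> _]; rewrite !inE eqxx ?orbT.
  by apply: IHk; case: abst => -[-> ->]; [right|left].
by move=> r; rewrite !inE => /orP[]/eqP ->; rewrite -[cgen _]cgenV rdmV.
Qed.

(** Equality in the positive braid monoid, presented on words without inverses. *)
Inductive meq : seq V -> seq V -> Prop :=
| meq_braid s t : s != t -> meq (alt (M s t) s t) (alt (M s t) t s)
| meq_refl u : meq u u
| meq_sym u v : meq u v -> meq v u
| meq_trans u v (w : seq V) : meq u v -> meq v w -> meq u w
| meq_cat u u' v v' : meq u u' -> meq v v' -> meq (u ++ v) (u' ++ v').

Lemma meq_size u v : meq u v -> size u = size v.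
Proof.
elim=> {u v} [s t _|//|//|u v w _ -> //|u u' v v' _ Eu _ Ev].
  by rewrite !size_alt.
by rewrite !size_cat Eu Ev.
Qed.

Lemma meq_mem u v : meq u v -> u =i v.
Proof.
elim=> {u v} [s t st r|//|u v _ IH r|u v w _ IH1 _ IH2 r|u u' v v' _ Eu _ Ev r].
- have E k : 1 < k -> forall a b, (r \in alt k a b) = (r \in [:: a; b]).
    move=> k1 a b; case: k k1 => [|[|k]] // _; rewrite !inE.
    suff h n a' b' : r \in alt n a' b' -> (r == a') || (r == b').
      case: eqVneq => //= ra; case: eqVneq => //= rb; apply/negP => /h.
      by rewrite (negbTE ra) (negbTE rb).
    elim: n a' b' => //= n IHn a' b'; rewrite inE => /orP[-> //|/IHn].
    by rewrite orbC.
  by rewrite !E ?m_lab_ge2 // !inE orbC.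
- by rewrite IH.
- by rewrite IH1.
- by rewrite !mem_cat Eu Ev.
Qed.

Lemma meq_cons s u v : meq u v -> meq (s :: u) (s :: v).
Proof. by move=> uv; rewrite -cat1s -(cat1s s v); apply: meq_cat => //; apply: meq_refl. Qed.

(** If the first letters [s] and [t] differ, [braid s t] is a prefix of the element. By induction on
    the tails, each word is equivalent to one beginning with an alternating word of length [M s t],
    and these differ by one braid relation. *)
Lemma matsumoto u v : reduced M u -> reduced M v -> cword u = cword v -> meq u v.
Proof.
move=> ru rv E; have Esz : size u = size v.
  by move: ru rv; rewrite /reduced E => /eqP -> /eqP ->.
have [n] := ubnP (size u); elim: n u v ru rv E Esz => // n IHn.
move=> [|s u] [|t v] //; first by move=> *; apply: meq_refl.
move=> rsu rtv E [Esz]; rewrite ltnS => un.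
have [ru su] := reduced_cons rsu; have [rv tv] := reduced_cons rtv.
case: (eqVneq s t) => [st|st].
  by subst t; apply: meq_cons; apply: IHn => //; move: E => /= /mulgI.
have : prefix_of (braid s t) (cword (s :: u)).
  by apply: prefix_braid => //; [|rewrite E]; rewrite prefixM.
case/prefix_ofP => x bx Ex.
have step a c b : (a, b) = (s, t) \/ (a, b) = (t, s) -> reduced M (a :: c) ->
    cword (a :: c) = cword (s :: u) -> size c = size u ->
    meq (a :: c) (alt (M s t) a b ++ red x).
  move=> abst rac Ec Esc.
  have Eab : braid a b = braid s t by case: abst => -[-> ->] //; rewrite braid_sym.
  have Em : M a b = M s t by case: abst => -[-> ->] //; rewrite m_lab_sym.
  have [rc _] := reduced_cons rac.
  have ab : a != b by case: abst => -[-> ->] //; rewrite eq_sym.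
  have Ealt : alt (M s t) a b = a :: alt (M s t).-1 b a.
    by have := m_lab_ge2 M st; case: (M s t).
  have Ew : cword (a :: c) = cword (alt (M s t) a b ++ red x).
    by rewrite Ec Ex cword_cat cword_red -Em -[cword (alt _ _ _)]/(braid a b) Eab.
  have rw : reduced M (alt (M s t) a b ++ red x).
    rewrite /reduced -Ew size_cat size_alt size_red -(len_braid st) -(rdmP _ _ bx) -Ex.
    by rewrite Ec.
  rewrite Ealt cat_cons; apply: meq_cons; rewrite Ealt cat_cons in Ew rw.
  have [rw' _] := reduced_cons rw.
  move: Ew => /= /mulgI Ew; apply: IHn => //; last by rewrite Esc.
  by move: rc rw'; rewrite /reduced -Ew => /eqP -> /eqP ->.
apply: meq_trans (step s u t (or_introl erefl) rsu erefl erefl) _.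
apply: meq_trans (meq_sym (step t v s (or_intror erefl) rtv _ _)) => //.
by apply: meq_cat (meq_refl _); apply: meq_braid.
Qed.

Lemma meq_red u : reduced M u -> meq (red (cword u)) u.
Proof. by move=> ru; apply: matsumoto => //; [apply: red_reduced | rewrite cword_red]. Qed.

Lemma meq_redM (v w : W) : rdm v w -> meq (red (v * w)) (red v ++ red w).
Proof.
move=> vw; apply: matsumoto; first exact: red_reduced; last by rewrite cword_cat !cword_red.
by apply: reduced_cat; rewrite ?cword_red //; apply: red_reduced.
Qed.

Lemma meq_red_gen s : meq (red (cgen s)) [:: s].
Proof.
have := @meq_red [:: s]; rewrite /= mulg1; apply.
by rewrite /reduced /= mulg1 len_cgen.
Qed.

(** * Maxima in the weak order and longest elements *)

Section FiniteType.
Hypothesis Mfin : finite_type M.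

Lemma len_bounded : exists N, forall w, len w <= N.
Proof.
have /finite_seqP[l El] := Mfin; exists (\max_(w <- l) len w)%N => w.
by apply: leq_bigmax_seq => //; have : [set` l]%classic w by rewrite -El.
Qed.

(** The join of two covers [w * cgen s] and [w * cgen t] is [w * braid s t], so [local_join_max]
    applies. *)
Lemma prefix_max (A : W -> Prop) : A 1 ->
  (forall x w, prefix_of x w -> A w -> A x) ->
  (forall w s t, s != t -> rdm w (cgen s) -> rdm w (cgen t) ->
     A (w * cgen s) -> A (w * cgen t) -> A (w * braid s t)) ->
  exists2 m, A m & forall z, A z -> prefix_of z m.
Proof.
move=> A1 Apre Abraid; have [N lenN] := len_bounded.
pose cov w c := exists2 s, rdm w (cgen s) & c = w * cgen s.
apply: (@local_join_max _ A (fun x y => prefix_of x y) cov (@len _ M) N 1) => //.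
- move=> x. apply: prefix_of_refl.
- by move=> x y z; apply: prefix_of_trans.
- by move=> x _; apply: prefix1.
- by move=> x c [s /rdmP E ->]; rewrite E len_cgen addn1.
- move=> x y Ax Ay /prefix_ofP[z xz Ez]; case Er : (red z) => [|s u].
    by left; rewrite Ez -[z]cword_red Er mulg1.
  have := red_reduced z; rewrite Er => /reduced_cons[_ su].
  have Ezs : z = cgen s * cword u by rewrite -[z]cword_red Er.
  rewrite Ezs in xz; have [xs xsu] := rdmAr su xz.
  have pre : prefix_of (x * cgen s) y by rewrite Ez Ezs mulgA prefixM.
  by right; exists (x * cgen s); split=> //; [apply: Apre Ay | exists s].
- move=> x c1 c2 Ac1 Ac2 [s xs E1] [t xt E2]; subst c1 c2; case: (eqVneq s t) => [->|st].
    by exists (x * cgen t); split=> //; apply: prefix_of_refl.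
  have xb := rdm_braid st xs xt.
  exists (x * braid s t); split; first exact: Abraid.
  + by apply: prefix_mul2l => //; apply: prefix_gen_braid.
  + rewrite -braid_sym // in xb *; apply: prefix_mul2l => //.
    by apply: prefix_gen_braid; rewrite eq_sym.
  + move=> b _ xsb xtb; have xb' : prefix_of x b.
      by apply: prefix_of_trans xsb; rewrite prefixM.
    case/prefix_ofP: xb' xsb xtb => y xy -> xsb xtb; apply: prefix_mul2l => //.
    by apply: prefix_braid => //; [apply: prefix_mulI xsb | apply: prefix_mulI xtb].
Qed.

Section LongestElement.
Variable X : {set V}.

Lemma inW_prefix w x : prefix_of w x -> inW X x -> inW X w.
Proof.
move=> /prefix_ofP[y wy ->] xX; have [b [e [bX eX Ew]]] := coset_decomposition X w.
have e1 : prefix_of e 1.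
  apply: (coset_rep_mono bX eX xX); first by move=> s _; apply: rdm1r.
  by rewrite mulg1 -Ew prefixM.
by rewrite Ew (prefix_eq e1) ?len1 // mulg1.
Qed.

Lemma longest_subproof : exists2 m, inW X m & forall w, inW X w -> prefix_of w m.
Proof.
apply: prefix_max; first exact: inW1; first exact: inW_prefix.
move=> w s t st ws wt wsX wtX.
have wX : inW X w by apply: inW_prefix wsX; rewrite prefixM.
have mem r : inW X (w * cgen r) -> inW X (cgen r).
  by move=> wrX; rewrite -[cgen r](mulKg w); apply: inWM => //; apply: inWV.
apply: inWM => //; rewrite /braid; move: (M s t) => k.
elim: k s t {st} ws wt wsX wtX => [|k IHk] s t ws wt wsX wtX; first exact: inW1.
by apply: inWM; [apply: mem | apply: IHk].
Qed.

Definition longest : W := sval (cid2 longest_subproof).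

Lemma inW_longest : inW X longest.
Proof. by rewrite /longest; case: cid2. Qed.

Lemma prefix_longest w : inW X w -> prefix_of w longest.
Proof. by rewrite /longest; case: cid2 => m mX max /max. Qed.

Lemma longestV : longest^-1 = longest.
Proof. by apply: prefix_eq; [apply/prefix_longest/inWV/inW_longest | rewrite lenV]. Qed.

Lemma longest2 : longest * longest = 1.
Proof. by rewrite -{1}longestV mulVg. Qed.

Lemma len_longestM w : inW X w -> len longest = len w + len (w * longest).
Proof. by move/inWV/prefix_longest; rewrite /prefix_of /rdm mulVKg invgK lenV => /eqP. Qed.

Lemma rdm_longest_gen s : s \in X -> ~ rdm longest (cgen s).
Proof.
move=> sX /rdmP E; have /prefix_len := prefix_longest (inWM inW_longest (inW_gen M sX)).
by rewrite E len_cgen addn1 ltnn.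
Qed.

(** By [len_longestM], [longest * cgen s * longest] has length one, so it is a generator of [X]. *)
Lemma longest_conj s : s \in X -> exists2 t, t \in X & longest * cgen s = cgen t * longest.
Proof.
move=> sX; have yX : inW X (longest * cgen s).
  by apply: inWM; [apply: inW_longest | apply: inW_gen].
have [/rdm_longest_gen //|Ey] := rdm_or_shorter longest s.
have [[|t [|r u]] [uX Eu ru]] := inW_reduced (inWM yX inW_longest);
  move: ru; rewrite /reduced; have := len_longestM yX; rewrite Ey -Eu => E /eqP /=.
- by move=> E'; exfalso; move: E; rewrite -E' addn0 => /eqP; rewrite gtn_eqF.
- move=> _; exists t; first by apply: uX; rewrite mem_head.
  by move: Eu; rewrite /= mulg1 => ->; rewrite -[RHS]mulgA longest2 mulg1.
- by move=> E'; exfalso; move: E; rewrite -E'; lia_len.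
Qed.

(* Conjugation by the longest element turns a last letter of [a^-1 longest]
   into a generator of [X] that is not a left descent of [a]. *)
Lemma full_descents a : inW X a -> (forall s, s \in X -> prefix_of (cgen s) a) ->
  a = longest.
Proof.
move=> aX desc; suff E1 : a^-1 * longest = 1 by rewrite -[RHS](mulVKg a) E1 mulg1.
have cX : inW X (a^-1 * longest) by apply: inWM; [apply: inWV | apply: inW_longest].
have [u [uX Eu ru]] := inW_reduced cX; move: uX Eu ru.
case/lastP: u => [_ <- //|u r] urX Eu ru; exfalso.
have rX : r \in X by rewrite urX // mem_rcons mem_head.
have [s sX Es] := longest_conj rX.
have saX : inW X (cgen s * a) by apply: inWM => //; apply: inW_gen.
have := len_longestM (inWV saX); have := len_longestM (inWV aX).
rewrite !lenV invgM cgenV -[a^-1 * _ * _]mulgA -Es (prefix_cgen (desc s sX)) mulgA.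
have : len (a^-1 * longest * cgen r) < len (a^-1 * longest).
  move: ru; rewrite -Eu -cats1 /reduced cword_cat /= mulg1 -[_ * _ * _]mulgA cgen2 mulg1.
  by move/eqP <-; rewrite size_cat addn1 ltnS len_cword.
by lia_len.
Qed.

(** In [w = a * e] with [a] in the subgroup of [X] and [e] minimal, descents of [w] in [X] are
    descents of [a], so [a] is [longest]. *)
Lemma longest_min w : (forall s, s \in X -> prefix_of (cgen s) w) -> prefix_of longest w.
Proof.
move=> desc; have [a [e [aX eX Ew]]] := coset_decomposition X w.
suff <- : a = longest by rewrite Ew prefixM (rdm_lred aX eX).
apply: full_descents => // s sX; case: (rdm_or_prefix s a) => // /rdmP sa.
have /rdmP := rdm_lred (inWM (inW_gen M sX) aX) eX.
have /rdmP := rdm_lred aX eX; have := prefix_cgen (desc s sX); rewrite Ew -mulgA.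
by rewrite sa len_cgen => h1 h2 h3; exfalso; lia_len.
Qed.

End LongestElement.

End FiniteType.
End Braids.

(** * The positive monoid *)

Add Parametric Relation (V : finType) (M : artin_data V) : (seq V) (meq M)
  reflexivity proved by (@meq_refl V M)
  symmetry proved by (@meq_sym V M)
  transitivity proved by (@meq_trans V M)
  as meq_equivalence.

#[global] Instance cat_meq_morphism (V : finType) (M : artin_data V) :
  Morphisms.Proper (Morphisms.respectful (meq M)
    (Morphisms.respectful (meq M) (meq M))) (@cat V).
Proof. by move=> u u' uu' v v'; apply: meq_cat. Qed.

#[global] Instance cons_meq_morphism (V : finType) (M : artin_data V) (s : V) :
  Morphisms.Proper (Morphisms.respectful (meq M) (meq M)) (cons s).
Proof. by move=> u u'; apply: meq_cons. Qed.

Section PositiveMonoid.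
Variables (V : finType) (M : artin_data V).
Hypothesis Mfin : finite_type M.
Local Notation W := (coxeter_group M).
Local Notation cgen := (cgen M).
Local Notation cword := (cword M).
Local Notation "u ~ v" := (meq M u v) (at level 70).
Local Notation longest := (longest Mfin).
Implicit Types (w x y z : W) (X : {set V}) (s t : V) (u v : seq V).

(** [prefix_braid] and [rdm_braid] close the candidates under joins of two covers, as [prefix_max]
    requires. *)
Lemma greedy_subproof x w : exists2 p, prefix_of p w /\ rdm x p
  & forall q, prefix_of q w /\ rdm x q -> prefix_of q p.
Proof.
apply: (prefix_max Mfin); first by split; [apply: prefix1 | apply: rdm1r].
  move=> p q pq [qw xq]; split; first exact: prefix_of_trans qw.
  exact: rdm_prefix pq.
move=> p s t st ps pt [psw xps] [ptw xpt]; have pst := rdm_braid st ps pt; split.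
  have pw : prefix_of p w by apply: prefix_of_trans psw; rewrite prefixM.
  case/prefix_ofP: pw psw ptw => y py -> psy pty; apply: prefix_mul2l => //.
  by apply: prefix_braid => //; [apply: prefix_mulI psy | apply: prefix_mulI pty].
have [xp xps'] := rdmAr ps xps; have [_ xpt'] := rdmAr pt xpt.
by have [] := rdmAl xp (rdm_braid st xps' xpt').
Qed.

Definition greedy x w : W := sval (cid2 (greedy_subproof x w)).

Lemma greedy_prefix x w : prefix_of (greedy x w) w.
Proof. by rewrite /greedy; case: cid2 => p []. Qed.

Lemma greedy_rdm x w : rdm x (greedy x w).
Proof. by rewrite /greedy; case: cid2 => p []. Qed.

Lemma greedy_max x w q : prefix_of q w -> rdm x q -> prefix_of q (greedy x w).
Proof. by move=> qw xq; rewrite /greedy; case: cid2 => p ? /=; apply. Qed.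

Lemma greedy_eq x w p : prefix_of p w -> rdm x p ->
  (forall q, prefix_of q w -> rdm x q -> prefix_of q p) -> greedy x w = p.
Proof.
move=> pw xp pmax; apply: prefix_anti; last exact: greedy_max.
by apply: pmax; [apply: greedy_prefix | apply: greedy_rdm].
Qed.

(* A pair [(w, u)] stands for the positive element [w u] with its simple
   part [w] singled out; a simple [x] acts by absorbing as much of [w] as
   possible. Since this respects the braid relations, the greedy greedy and
   remainder of a positive element are well defined. *)
Definition absorb x (p : W * seq V) : W * seq V :=
  (x * greedy x p.1, red ((greedy x p.1)^-1 * p.1) ++ p.2).

Definition pair_eq (p q : W * seq V) := p.1 = q.1 /\ p.2 ~ q.2.

Lemma pair_eq_refl p : pair_eq p p.
Proof. by split=> //; reflexivity. Qed.

Lemma pair_eq_sym p q : pair_eq p q -> pair_eq q p.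
Proof. by case=> E1 E2; split=> //; symmetry. Qed.

Lemma pair_eq_trans p q r : pair_eq p q -> pair_eq q r -> pair_eq p r.
Proof. by case=> E1 E2 [E3 E4]; split; [rewrite E1 | transitivity q.2]. Qed.

Lemma absorb_eq x p q : pair_eq p q -> pair_eq (absorb x p) (absorb x q).
Proof. by case: p q => [w u] [w' u'] [/= <- E]; split=> //=; rewrite E; reflexivity. Qed.

(** From [y * q], the element [x] takes all of [y], because [rdm x y]; what it takes of [q] is
    exactly the part [p] of [w] that [x * y] absorbs. *)
Lemma absorbM x y p : rdm x y -> pair_eq (absorb x (absorb y p)) (absorb (x * y) p).
Proof.
case: p => w u xy; set p := greedy (x * y) w; set q := greedy y w.
have yq : rdm y q := greedy_rdm y w; have qw : prefix_of q w := greedy_prefix y w.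
have [yp xyp] : rdm y p /\ rdm x (y * p) := rdmAl xy (greedy_rdm (x * y) w).
have pw : prefix_of p w := greedy_prefix (x * y) w.
have pq : prefix_of p q := greedy_max pw yp.
have Eh : greedy x (y * q) = y * p.
  apply: greedy_eq => //; first exact: prefix_mul2l.
  move=> r ryq xr; have : prefix_of y (greedy x (y * q)) by apply: greedy_max; rewrite ?prefixM.
  case/prefix_ofP => z yz Ez; have rz : prefix_of r (y * z) by rewrite -Ez; apply: greedy_max.
  apply: prefix_of_trans rz _; apply: prefix_mul2l => //; apply: greedy_max.
    apply: prefix_of_trans qw; apply: (@prefix_mulI _ _ y) => //.
    by rewrite -Ez; apply: greedy_prefix.
  by have := greedy_rdm x (y * q); rewrite Ez => /(rdmAr yz)[].
split=> /=; rewrite -/p -/q Eh; first by rewrite mulgA.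
rewrite catA; apply: meq_cat; last by reflexivity.
have -> : (y * p)^-1 * (y * q) = p^-1 * q by rewrite invgM -mulgA mulKg.
have -> : p^-1 * w = p^-1 * q * (q^-1 * w) by rewrite -mulgA mulVKg.
symmetry; apply: meq_redM.
have : rdm p (p^-1 * q) := pq; have : rdm (p * (p^-1 * q)) (q^-1 * w) by rewrite mulVKg.
by move=> h1 h2; have [] := rdmAl h2 h1.
Qed.

Lemma absorb1 p : pair_eq (absorb 1 p) p.
Proof.
case: p => w u; have E : greedy 1 w = w.
  by apply: greedy_eq => //; [apply: prefix_of_refl | apply: rdm1l].
by split; rewrite /= E ?mul1g // mulVg red1; reflexivity.
Qed.

Definition absorb_word u p := foldr (fun s => absorb (cgen s)) p u.

Lemma absorb_word_cat u v p : absorb_word (u ++ v) p = absorb_word u (absorb_word v p).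
Proof. exact: foldr_cat. Qed.

Lemma absorb_word_eq u p q : pair_eq p q -> pair_eq (absorb_word u p) (absorb_word u q).
Proof. by move=> pq; elim: u => //= s u; apply: absorb_eq. Qed.

Lemma absorb_word_reduced u p : reduced M u -> pair_eq (absorb_word u p) (absorb (cword u) p).
Proof.
elim: u => [_|s u IHu]; first exact/pair_eq_sym/absorb1.
move=> /reduced_cons[ru su] /=.
by apply: pair_eq_trans (absorb_eq _ (IHu ru)) (absorbM _ su).
Qed.

Lemma absorb_word_meq u v p : u ~ v -> pair_eq (absorb_word u p) (absorb_word v p).
Proof.
move=> uv; elim: uv p => {u v} [s t st|u|u v _ IH|u v w _ IH1 _ IH2|u u' v v' _ IH1 _ IH2] p.
- apply: pair_eq_trans (absorb_word_reduced _ _) _; first exact: reduced_alt.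
  rewrite cword_braid //; apply/pair_eq_sym/absorb_word_reduced.
  by rewrite m_lab_sym; apply: reduced_alt; rewrite // eq_sym.
- exact: pair_eq_refl.
- exact: pair_eq_sym.
- exact: pair_eq_trans (IH1 p) (IH2 p).
- rewrite !absorb_word_cat; apply: pair_eq_trans (IH1 _) _.
  exact: absorb_word_eq.
Qed.

Lemma absorb_sound x p : red (absorb x p).1 ++ (absorb x p).2 ~ red x ++ red p.1 ++ p.2.
Proof.
case: p => w u /=; rewrite (meq_redM (greedy_rdm x w)) -catA (catA (red (greedy x w))).
by rewrite -(meq_redM (greedy_prefix x w)) mulVKg; reflexivity.
Qed.

Lemma absorb_word_sound u p :
  red (absorb_word u p).1 ++ (absorb_word u p).2 ~ u ++ red p.1 ++ p.2.
Proof.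
elim: u => [|s u IHu]; first by reflexivity.
by rewrite absorb_sound -/(absorb_word u p) IHu meq_red_gen; reflexivity.
Qed.

(** The greatest simple left divisor of [u]; with [remainder], its cofactor, it depends on [u] only
    up to [meq]. *)
Definition simple_part u : W := (absorb_word u (1, [::])).1.
Definition remainder u : seq V := (absorb_word u (1, [::])).2.

Lemma simple_part_remainder u : red (simple_part u) ++ remainder u ~ u.
Proof. by rewrite absorb_word_sound /= red1 /= cats0; reflexivity. Qed.

Lemma simple_part_meq u v : u ~ v -> simple_part u = simple_part v.
Proof. by move/(absorb_word_meq (1, [::])) => []. Qed.

Lemma remainder_meq u v : u ~ v -> remainder u ~ remainder v.
Proof. by move/(absorb_word_meq (1, [::])) => []. Qed.

Lemma absorb_word_redl w v : pair_eq (absorb_word (red w ++ v) (1, [::]))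
  (absorb w (simple_part v, remainder v)).
Proof.
rewrite absorb_word_cat -surjective_pairing -{2}[w]cword_red.
exact: absorb_word_reduced (red_reduced w).
Qed.

Lemma simple_part_redl w v : simple_part (red w ++ v) = w * greedy w (simple_part v).
Proof. by case: (absorb_word_redl w v). Qed.

Lemma simple_part_max w u v : u ~ red w ++ v -> prefix_of w (simple_part u).
Proof. by move/simple_part_meq ->; rewrite simple_part_redl prefixM greedy_rdm. Qed.

(** * Garside elements and cancellation *)

Definition delta X : seq V := red (longest X).

Let delta0 := delta [set: V]%SET.

Lemma inW_setT w : inW [set: V]%SET w.
Proof. by exists (red w); [move=> s _; rewrite inE | apply: cword_red]. Qed.

(** The longest element can absorb nothing, so [remainder] recovers [u] from [delta0 ++ u]. *)
Lemma delta_cancel u v : delta0 ++ u ~ delta0 ++ v -> u ~ v.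
Proof.
have rem r : remainder (delta0 ++ r) ~ r.
  have [_ /=] := absorb_word_redl (longest [set: V]%SET) r; rewrite -/(remainder _) => ->.
  set h := greedy _ _; have -> : h = 1.
    apply: len_eq0; have /rdmP E := greedy_rdm (longest [set: V]%SET) (simple_part r).
    have /prefix_len := prefix_longest Mfin (inW_setT (longest [set: V]%SET * h)).
    by rewrite E -{2}[len (longest _)]addn0 leq_add2l leqn0 => /eqP.
  by rewrite invg1 mul1g; apply: simple_part_remainder.
by move=> /remainder_meq; rewrite !rem.
Qed.

Lemma delta_last X s : s \in X -> delta X ~ red (longest X * cgen s) ++ [:: s].
Proof.
move=> sX; have E : longest X = longest X * cgen s * cgen s by rewrite -mulgA cgen2 mulg1.
rewrite -(meq_red_gen M s) -meq_redM -?E; first by reflexivity.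
have [|El] := rdm_or_shorter (longest X) s; first by move/(rdm_longest_gen sX).
by rewrite /rdm -E El len_cgen addn1.
Qed.

Lemma delta_first X s : s \in X -> delta X ~ s :: red (cgen s * longest X).
Proof.
move=> sX; have sl := prefix_longest Mfin (inW_gen M sX).
rewrite -cat1s -(meq_red_gen M s) -meq_redM ?cgenK; first by reflexivity.
by rewrite -[X in rdm _ (X * _)]cgenV.
Qed.

Lemma delta_conj X s : s \in X -> exists2 t, t \in X
  & (delta X ++ [:: s] ~ t :: delta X) /\ (delta X ++ [:: t] ~ s :: delta X).
Proof.
have conj1 a b : a \in X -> b \in X -> longest X * cgen a = cgen b * longest X ->
    delta X ++ [:: a] ~ b :: delta X.
  move=> aX bX E; rewrite {1}(delta_first bX) cat_cons -E -(delta_last aX).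
  by reflexivity.
move=> sX; have [t tX E] := longest_conj Mfin sX; exists t => //; split; apply: conj1 => //.
apply: (mulgI (longest X)); rewrite !mulgA longest2 mul1g E -mulgA longest2.
by rewrite mulg1.
Qed.

(** [delta X] permutes the letters of [X] by an involution ([delta_conj]), so its square fixes
    them. *)
Lemma delta2_comm X u : {subset u <= X} ->
  (delta X ++ delta X) ++ u ~ u ++ (delta X ++ delta X).
Proof.
elim: u => [|s u IHu] uX; first by rewrite cats0; reflexivity.
have [|t tX [E1 E2]] := @delta_conj X s; first by rewrite uX ?mem_head.
have Es : (delta X ++ delta X) ++ [:: s] ~ [:: s] ++ (delta X ++ delta X).
  by rewrite -catA E1 -cat1s catA E2; reflexivity.
rewrite -cat1s catA Es /= IHu; first by reflexivity.
by move=> r ru; rewrite uX // inE ru orbT.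
Qed.

Let c := delta0 ++ delta0.

Lemma garside_central u : c ++ u ~ u ++ c.
Proof. by apply: delta2_comm => s _; rewrite inE. Qed.

Lemma garside_cancel u v : c ++ u ~ c ++ v -> u ~ v.
Proof. by rewrite /c -!catA => /delta_cancel/delta_cancel. Qed.

(** Multiplying on the left by the complement of [s] turns the letter into [delta0], which
    cancels. *)
Lemma meq_consI s u v : s :: u ~ s :: v -> u ~ v.
Proof.
move=> E; apply: delta_cancel; have sV : s \in [set: V]%SET by rewrite inE.
by rewrite /delta0 (delta_last sV) -!catA /= E; reflexivity.
Qed.

(** The complement of [s] in the central [c]: in the group, the inverse of [s] is this element
    divided by [c]. *)
Definition cogen s : seq V := red (cgen s * longest [set: V]%SET) ++ delta0.

Lemma gen_cogen s : s :: cogen s ~ c.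
Proof. by rewrite /c /delta0 {1}(@delta_first [set: V]%SET s) ?inE //; reflexivity. Qed.

Lemma cogen_gen s : cogen s ++ [:: s] ~ c.
Proof.
by apply: (@meq_consI s); rewrite -cat_cons gen_cogen garside_central; reflexivity.
Qed.

(** * Fractions with central denominators *)

Fixpoint garside_power (k : nat) : seq V :=
  if k is k'.+1 then c ++ garside_power k' else [::].

Lemma garside_powerD k l : garside_power (k + l) = garside_power k ++ garside_power l.
Proof. by elim: k => //= k ->; rewrite catA. Qed.

Lemma garside_power_central k u : garside_power k ++ u ~ u ++ garside_power k.
Proof.
elim: k => [|k IHk] /=; first by rewrite cats0; reflexivity.
by rewrite -catA IHk catA garside_central -catA; reflexivity.
Qed.

Lemma garside_power_cancel k u v : garside_power k ++ u ~ garside_power k ++ v -> u ~ v.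
Proof. by elim: k => //= k IHk; rewrite -![(c ++ _) ++ _]catA => /garside_cancel/IHk. Qed.

(* A signed word denotes the fraction [c ^ (- fden w) (fnum w)]. *)
Definition fden (w : word V) : nat := count (fun a => a.2) w.
Definition fnum (w : word V) : seq V :=
  flatten [seq if a.2 then cogen a.1 else [:: a.1] | a <- w].

Lemma fnum_pos u : fnum (pos u) = u.
Proof. by elim: u => //= s u IHu; rewrite /fnum /= -/(fnum _) IHu. Qed.

Lemma fden_pos u : fden (pos u) = 0.
Proof. by elim: u. Qed.

(** Equality of fractions with denominators cleared; transitivity holds because the middle
    denominator is central and cancels. *)
Lemma pres_eq_fraction (w w' : word V) : pres_eq (artin_rel M) w w' ->
  garside_power (fden w') ++ fnum w ~ garside_power (fden w) ++ fnum w'.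
Proof.
elim=> {w w'} [w w' [s [t [st -> ->]]]|s b|w|w w' _ IH|w1 w2 w3 _ IH1 _ IH2|].
- by rewrite -!pos_alt !fden_pos !fnum_pos; apply: meq_braid.
- case: b; rewrite /fden /fnum /= !cats0; first exact: cogen_gen.
  exact: gen_cogen.
- by reflexivity.
- by symmetry.
- apply: (@garside_power_cancel (fden w2)).
  rewrite catA -garside_powerD addnC garside_powerD -catA IH1 catA.
  by rewrite -garside_powerD addnC garside_powerD -catA IH2 !catA -!garside_powerD addnC;
    reflexivity.
- move=> w1 w2 w3 w4 _ IH1 _ IH2.
  rewrite /fden /fnum !count_cat !map_cat !flatten_cat -!/(fden _) -!/(fnum _).
  have swap k l p q : garside_power (k + l) ++ p ++ q ~
      (garside_power k ++ p) ++ (garside_power l ++ q).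
    by rewrite garside_powerD -!catA (catA (garside_power l)) (garside_power_central l p)
      -!catA; reflexivity.
  by rewrite !swap IH1 IH2; reflexivity.
Qed.

Lemma artin_embed u v : pres_eq (artin_rel M) (pos u) (pos v) -> u ~ v.
Proof. by move/pres_eq_fraction; rewrite !fden_pos !fnum_pos. Qed.

End PositiveMonoid.

(** * Divisibility and conjugation in the Artin group *)

Local Open Scope classical_set_scope.
Local Open Scope group_scope.

Section Submonoids.
Variable G : groupType.
Implicit Types (B : set G) (x y g h : G).

Lemma gen_submonoid_gen B x : B x -> gen_submonoid B x.
Proof. by move=> Bx H [_]; apply. Qed.

Lemma gen_submonoid1 B : gen_submonoid B 1.
Proof. by move=> H [[/set_mem]]. Qed.

Lemma gen_submonoidM B x y : gen_submonoid B x -> gen_submonoid B y ->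
  gen_submonoid B (x * y).
Proof.
move=> Bx By H [cH BH]; case: (cH) => _ HM.
by apply/set_mem/HM; apply/mem_set; [apply: Bx|apply: By].
Qed.

Lemma gen_subgroup_gen B x : B x -> gen_subgroup B x.
Proof. by move=> Bx H [_]; apply. Qed.

Lemma gen_subgroup_closed B : group_closed [in gen_subgroup B].
Proof.
split; first by apply/mem_set => H [[/set_mem]].
move=> x y /set_mem Bx /set_mem By; apply/mem_set => H [cH BH]; case: (cH) => _ HM.
by apply/set_mem/HM; apply/mem_set; [apply: Bx|apply: By].
Qed.

Lemma gen_subgroup_conj B B' g : (forall x, B x -> gen_subgroup B' (x ^ g)) ->
  forall x, gen_subgroup B x -> gen_subgroup B' (x ^ g).
Proof.
move=> BB' x Bx; have [c1 cM] := gen_subgroup_closed B'.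
suff : [set y | gen_subgroup B' (y ^ g)] x by [].
apply: Bx; split=> // ; split; first by apply/mem_set; rewrite /= conj1g; apply/set_mem.
move=> y z /set_mem/= By /set_mem/= Bz; apply/mem_set; rewrite /= conjMg conjVg.
by apply/set_mem/cM; apply/mem_set.
Qed.

Lemma conj_setM x y (A : set G) : conj_set (x * y) A = conj_set x (conj_set y A).
Proof.
apply/seteqP; split=> z /=.
  by case=> a Aa <-; exists (y * a * y^-1); [exists a | rewrite invgM !mulgA].
by case=> _ [a Aa <-] <-; exists a; rewrite // invgM !mulgA.
Qed.

Lemma conj_set_commute x (A : set G) : (forall a, A a -> commute x a) -> conj_set x A = A.
Proof.
move=> cA; apply/seteqP; split=> [_ [a Aa <-]|a Aa]; first by rewrite cA // mulgK.
by exists a; rewrite // cA // mulgK.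
Qed.

Lemma conj_setVE x (A : set G) : conj_set x^-1 A = [set a ^ x | a in A].
Proof.
by apply/seteqP; split=> z [a Aa <-]; exists a; rewrite // conjgE invgK mulgA.
Qed.

End Submonoids.

(** * Positive elements and their divisors *)

Section ArtinGroup.
Variables (V : finType) (M : artin_data V).
Hypothesis Mfin : finite_type M.
Local Notation W := (coxeter_group M).
Local Notation G := (artin_group M).
Local Notation cgen := (cgen M).
Local Notation cword := (cword M).
Local Notation "u ~ v" := (meq M u v) (at level 70).
Local Notation longest := (longest Mfin).
Local Notation delta := (delta Mfin).
Implicit Types (w x y z : W) (X : {set V}) (s t : V) (u v : seq V) (a b c d g h : G).

Definition aword u : G := pres_class (artin_rel M) (pos u).

Lemma aword_cat u v : aword (u ++ v) = aword u * aword v.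
Proof. by rewrite /aword pos_cat -pres_mulE. Qed.

Lemma aword_cons s u : aword (s :: u) = artin_gen M s * aword u.
Proof. exact: (aword_cat [:: s]). Qed.

Lemma aword_meq u v : u ~ v -> aword u = aword v.
Proof.
elim=> {u v} [s t st|//|//|u v w _ -> //|u u' v v' _ Eu _ Ev].
  by apply/pres_classP/pres_rel; exists s, t; rewrite !pos_alt.
by rewrite !aword_cat Eu Ev.
Qed.

Lemma awordP u v : aword u = aword v <-> u ~ v.
Proof. by split=> [/pres_classP/(artin_embed Mfin)|/aword_meq]. Qed.

Lemma positiveP g : positive g <-> exists u, g = aword u.
Proof.
split=> [pg|[u ->]].
  apply: (pg [set g | exists u, g = aword u]); split; last by move=> _ [s _ <-]; exists [:: s].
  split; first by apply/mem_set; exists [::].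
  by move=> x y /set_mem[u ->] /set_mem[v ->]; apply/mem_set; exists (u ++ v); rewrite aword_cat.
elim: u => [|s u IHu]; first exact: gen_submonoid1.
by rewrite aword_cons; apply: gen_submonoidM => //; apply: gen_submonoid_gen; exists s.
Qed.

Lemma positive_aword u : positive (aword u).
Proof. by apply/positiveP; exists u. Qed.

Lemma positive_gen s : positive (artin_gen M s).
Proof. exact: (positive_aword [:: s]). Qed.

Lemma positive1 : positive (1 : G).
Proof. exact: gen_submonoid1. Qed.

Lemma positiveM g h : positive g -> positive h -> positive (g * h).
Proof. exact: gen_submonoidM. Qed.

(** Well defined on positive elements because braid relations preserve length; the default gives 0
    elsewhere. *)
Definition adeg g : nat := size (xget [::] [set u | aword u = g]).

Lemma adeg_aword u : adeg (aword u) = size u.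
Proof.
apply: (@meq_size _ M); apply/awordP.
by apply: (@xgetPex _ [::] [set v | aword v = aword u]); exists u.
Qed.

Lemma adegM g h : positive g -> positive h -> adeg (g * h) = (adeg g + adeg h)%N.
Proof.
move=> /positiveP[u ->] /positiveP[v ->].
by rewrite -aword_cat !adeg_aword size_cat.
Qed.

Lemma adeg_eq0 g : positive g -> adeg g = 0 -> g = 1.
Proof. by move=> /positiveP[u ->]; rewrite adeg_aword => /size0nil ->. Qed.

Local Notation std_parabolic := (@std_parabolic V M).
Local Notation ldiv := (@left_divides V M).

Lemma ldiv_refl g : ldiv g g.
Proof. by exists 1; rewrite ?mulg1 //; apply: positive1. Qed.

Lemma ldiv_trans g h a : ldiv g h -> ldiv h a -> ldiv g a.
Proof.
by move=> [b pb ->] [c pc ->]; exists (b * c); rewrite ?mulgA //; apply: positiveM.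
Qed.

Lemma ldivM g h : positive h -> ldiv g (g * h).
Proof. by exists h. Qed.

Lemma ldiv_mul2l a g h : ldiv (a * g) (a * h) <-> ldiv g h.
Proof.
split=> -[b pb]; first by rewrite -mulgA => /mulgI ->; exists b.
by move=> ->; exists b; rewrite ?mulgA.
Qed.

Lemma ldiv_anti g h : ldiv g h -> ldiv h g -> g = h.
Proof.
move=> [a pa ->] [b pb]; rewrite -mulgA -{1}[g]mulg1 => /mulgI/esym E.
have := adegM pa pb; rewrite E (adeg_aword [::]) => /esym/eqP.
rewrite addn_eq0 => /andP[/eqP/(adeg_eq0 pa) -> _]; exact/esym/mulg1.
Qed.

Lemma ldiv_conj g a : ldiv g (a * g) <-> positive (a ^ g).
Proof.
split=> [[b pb E]|pag]; first by rewrite conjgE E mulKg.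
by exists (a ^ g) => //; rewrite conjgE mulVKg.
Qed.

Definition simple w : G := aword (red w).

Lemma simple_gen s : simple (cgen s) = artin_gen M s.
Proof. exact/(aword_meq (v := [:: s]))/meq_red_gen. Qed.

Lemma simpleM w x : rdm w x -> simple (w * x) = simple w * simple x.
Proof. by move=> wx; rewrite /simple -aword_cat; apply/aword_meq/meq_redM. Qed.

Lemma positive_simple w : positive (simple w).
Proof. exact: positive_aword. Qed.

Lemma ldiv_simple w x : prefix_of w x -> ldiv (simple w) (simple x).
Proof. by case/prefix_ofP => y wy ->; rewrite simpleM //; apply: ldivM; apply: positive_simple. Qed.

Lemma ldiv_aword w u : ldiv (simple w) (aword u) <-> prefix_of w (simple_part Mfin u).
Proof.
split=> [[_ /positiveP[v ->]]|wu].
  by rewrite -aword_cat => /awordP E; apply: simple_part_max E.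
rewrite -(aword_meq (simple_part_remainder Mfin u)) aword_cat.
apply: ldiv_trans (ldiv_simple wu) _; apply: ldivM; apply: positive_aword.
Qed.

(** The simple divisors of [a] are the prefixes of its simple part, so bounds in the weak order
    extend to all positive [a]. *)
Lemma ldiv_join (P : W -> Prop) x a :
  (forall w, (forall y, P y -> prefix_of y w) -> prefix_of x w) ->
  positive a -> (forall y, P y -> ldiv (simple y) a) -> ldiv (simple x) a.
Proof.
move=> lub /positiveP[u ->] Pa; apply/ldiv_aword/lub => y Py.
exact/ldiv_aword/Pa.
Qed.

(** [local_join_max] applies to the common divisors, ranked by word length: two covers of [c] by [s]
    and [t] have the join [c * simple (braid M s t)]. *)
Lemma positive_gcd a b : positive a -> positive b ->
  exists d, [/\ positive d, ldiv d a, ldiv d b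
    & forall e, positive e -> ldiv e a -> ldiv e b -> ldiv e d].
Proof.
move=> pa pb; pose A e := [/\ positive e, ldiv e a & ldiv e b].
pose cov c e := positive c /\ exists s, e = c * artin_gen M s.
have [||||||||d [pd da db] dmax] := @local_join_max _ A ldiv cov adeg (adeg a) 1.
- exact: ldiv_refl.
- exact: ldiv_trans.
- split; first exact: positive1.
    by rewrite -[a]mul1g; apply: ldivM.
  by rewrite -[b]mul1g; apply: ldivM.
- by move=> c [pc _ _]; rewrite -[c]mul1g; apply: ldivM.
- by move=> c [pc [e pe ->] _]; rewrite adegM // leq_addr.
- move=> c _ [pc [s ->]]; rewrite adegM ?(adeg_aword [:: s]) ?addn1 //.
  exact: positive_gen.
- move=> c e [pc ca cb] [pe ea eb] [_ /positiveP[[|s u] ->] Ee].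
    by left; rewrite Ee mulg1.
  right; exists (c * artin_gen M s).
  have ce : ldiv (c * artin_gen M s) e.
    by rewrite Ee aword_cons mulgA; apply: ldivM; apply: positive_aword.
  split=> //; last by split=> //; exists s.
  split; first by apply: positiveM => //; apply: positive_gen.
    exact: ldiv_trans ea.
  exact: ldiv_trans eb.
- move=> c e1 e2 Ae1 Ae2 [pc [s E1]] [_ [t E2]]; subst e1 e2.
  case: (eqVneq s t) => [<-|st].
    by exists (c * artin_gen M s); split=> //; apply: ldiv_refl.
  have braid_ldiv e : ldiv (c * artin_gen M s) e -> ldiv (c * artin_gen M t) e ->
      ldiv (c * simple (braid M s t)) e.
    move=> [f pf ->]; rewrite -!mulgA !ldiv_mul2l => tf.
    apply: (ldiv_join (P := fun y => y = cgen s \/ y = cgen t)).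
    + by move=> w wst; apply: prefix_braid => //; apply: wst; [left|right].
    + by apply: positiveM => //; apply: positive_gen.
    + by move=> _ [->|->]; rewrite simple_gen //; apply: ldivM.
  case: Ae1 Ae2 => [_ sa sb] [_ ta tb].
  exists (c * simple (braid M s t)); split.
  + by split; [apply: positiveM => //; apply: positive_simple | apply: braid_ldiv..].
  + by rewrite ldiv_mul2l -simple_gen; apply/ldiv_simple/prefix_gen_braid.
  + rewrite ldiv_mul2l -simple_gen -braid_sym //; apply/ldiv_simple/prefix_gen_braid.
    by rewrite eq_sym.
  + by move=> e _; apply: braid_ldiv.
- by exists d; split=> // e pe ea eb; apply: dmax.
Qed.

(** * Central shifts and positive conjugators *)

Definition garside2 : G := aword (delta [set: V]%SET ++ delta [set: V]%SET).

Lemma aword_class_ind (P : G -> Prop) : P 1 ->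
  (forall s g, P g -> P (artin_gen M s * g)) ->
  (forall s g, P g -> P ((artin_gen M s)^-1 * g)) -> forall g, P g.
Proof.
move=> P1 Pg PV g; rewrite -[g]pres_reprK; elim: (repr g) => [|[s b] w IHw] //.
rewrite -cat1s -pres_mulE; case: b; last exact: Pg.
by have := PV s _ IHw; rewrite [_^-1]pres_invE.
Qed.

Lemma garside2_commute g : commute garside2 g.
Proof.
have cs s : commute garside2 (artin_gen M s).
  by have := aword_meq (garside_central Mfin [:: s]); rewrite aword_cat [RHS]aword_cat.
elim/aword_class_ind: g => [|s g IHg|s g IHg]; first exact: commute1.
  exact: commuteM.
by apply: commuteM => //; apply: commuteV.
Qed.

Lemma garside2X_commute k g : commute (garside2 ^+ k) g.
Proof. by apply/commute_sym/commuteX/commute_sym/garside2_commute. Qed.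

Lemma positive_garside2X k : positive (garside2 ^+ k).
Proof.
elim: k => [|k IHk]; first exact: positive1.
by rewrite expgS; apply: positiveM => //; apply: positive_aword.
Qed.

(** One factor [garside2] absorbs each inverse generator, being a positive element times that
    generator. *)
Lemma positive_shift g : exists k, positive (garside2 ^+ k * g).
Proof.
elim/aword_class_ind: g => [|s g [k pk]|s g [k pk]].
- by exists 0; rewrite mulg1; apply: positive1.
- exists k; rewrite mulgA garside2X_commute -mulgA.
  by apply: positiveM => //; apply: positive_gen.
- exists k.+1.
  have E : garside2 = aword (cogen Mfin s) * artin_gen M s.
    by rewrite -(aword_cat _ [:: s]); apply/esym/aword_meq/cogen_gen.
  rewrite expgSr {2}E -!mulgA mulVKg mulgA garside2X_commute -mulgA.
  by apply: positiveM => //; apply: positive_aword.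
Qed.

Lemma conj_garside2X g h k : g ^ (h * garside2 ^+ k) = g ^ h.
Proof. by rewrite conjgM conjgE -garside2X_commute mulKg. Qed.

(** A central factor [c] makes [g] and [h] positive; then [c * g * d] is a gcd of [c * g * a] and
    [c * g * b], both divisible by [c * h]. *)
Lemma ldiv_gcd_translate a b d : positive a -> positive b -> positive d ->
  ldiv d a -> ldiv d b -> (forall e, positive e -> ldiv e a -> ldiv e b -> ldiv e d) ->
  forall g h, ldiv h (g * a) -> ldiv h (g * b) -> ldiv h (g * d).
Proof.
move=> pa pb pd da db dmax g h hga hgb.
have [k pkg] := positive_shift g; have [l plh] := positive_shift h.
pose c := garside2 ^+ k * garside2 ^+ l; rewrite -(ldiv_mul2l c).
have pcg : positive (c * g).
  rewrite /c garside2X_commute -mulgA.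
  by apply: positiveM => //; apply: positive_garside2X.
have pch : positive (c * h).
  by rewrite /c -mulgA; apply: positiveM => //; apply: positive_garside2X.
have [||m [pm ma mb mmax]] := @positive_gcd (c * g * a) (c * g * b).
- exact: positiveM.
- exact: positiveM.
have dm : ldiv (c * g * d) m by apply: mmax; rewrite ?ldiv_mul2l //; apply: positiveM.
have Em : m = c * g * d.
  case: dm ma mb => x px ->; rewrite -[_ * d * x]mulgA !ldiv_mul2l => dxa dxb.
  apply: ldiv_anti; last by rewrite ldiv_mul2l; apply: ldivM.
  by rewrite ldiv_mul2l; apply: dmax => //; apply: positiveM.
by rewrite mulgA -Em; apply: mmax; rewrite // -[c * g * _]mulgA ldiv_mul2l.
Qed.

(* A positive [c] conjugates [g] to a positive element iff [c] divides [g c];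
   this property is inherited by greatest common divisors. *)
Lemma minimal_positive_conjugator g : (exists h, positive (g ^ h)) ->
  exists c, [/\ positive c, positive (g ^ c)
    & forall c', positive c' -> positive (g ^ c') -> ldiv c c'].
Proof.
case=> h pgh; have [k pkh] := positive_shift h.
pose P n := `[< exists c, [/\ positive c, positive (g ^ c) & adeg c = n] >].
have exP : exists n, P n.
  exists (adeg (garside2 ^+ k * h)); apply/asboolP; exists (garside2 ^+ k * h).
  by rewrite garside2X_commute conj_garside2X -garside2X_commute.
case: (ex_minnP exP) => n /asboolP[c [pc pgc Ec]] minn; exists c; split=> // c' pc' pgc'.
have [d [pd dc dc' dmax]] := positive_gcd pc pc'.
have pgd : positive (g ^ d).
  (* [d] divides [c], which divides [g * c], and likewise for [c']; hence [d] divides [g * d]. *)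
  apply/ldiv_conj; apply: (ldiv_gcd_translate pc pc' pd dc dc' dmax).
    by apply: ldiv_trans dc _; apply/ldiv_conj.
  by apply: ldiv_trans dc' _; apply/ldiv_conj.
have nd : n <= adeg d by apply: minn; apply/asboolP; exists d.
suff <- : d = c by [].
case: dc Ec nd => e pe ->; rewrite adegM // => <-.
rewrite -{2}[adeg d]addn0 leq_add2l leqn0 => /eqP/(adeg_eq0 pe) ->.
by rewrite mulg1.
Qed.

Lemma simultaneous_positive_conjugator (zs : seq G) :
  {in zs &, forall a b, commute a b} ->
  {in zs, forall a, exists h, positive (a ^ h)} ->
  exists2 g, positive g & {in zs, forall a, positive (a ^ g)}.
Proof.
elim: zs => [|a zs IHzs] comm pos; first by exists 1; [exact: positive1 | move=> a].
have [||g pg gzs] := IHzs.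
- by move=> b d bz dz; apply: comm; rewrite inE ?bz ?dz orbT.
- by move=> b bz; apply: pos; rewrite inE bz orbT.
have [|c [pc pac cmin]] := @minimal_positive_conjugator (a ^ g).
  have [|h pah] := pos a; first exact: mem_head.
  by exists (g^-1 * h); rewrite -conjgM mulVKg.
exists (g * c); first exact: positiveM.
move=> b; rewrite inE => /orP[/eqP ->|bz]; first by rewrite conjgM.
(* [b ^ g] commutes with [a ^ g], hence [b ^ g * c] is another positive
   conjugator of [a ^ g], and the minimal one [c] divides it. *)
rewrite conjgM; apply/ldiv_conj/cmin; first by apply: positiveM => //; apply: gzs.
suff -> : (a ^ g) ^ (b ^ g * c) = (a ^ g) ^ c by [].
rewrite conjgM -conjJg; congr ((_ ^ _) ^ _).
have : commute a b by apply: comm; rewrite ?mem_head // inE bz orbT.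
by rewrite conjgE => ->; rewrite mulKg.
Qed.

(** * Conjugates of standard parabolic subgroups *)

Lemma Delta_delta X : Delta M X = aword (delta X).
Proof.
have lcm_delta : is_lcm X (aword (delta X)).
  split; first exact: positive_aword.
    move=> s sX; rewrite -simple_gen; apply: ldiv_simple.
    by apply: prefix_longest; apply: inW_gen.
  move=> e pe Xe; apply: (ldiv_join (P := fun y => exists2 s, s \in X & y = cgen s)) pe _.
    by move=> w Pw; apply: longest_min => s sX; apply: Pw; exists s.
  by move=> _ [s sX ->]; rewrite simple_gen; apply: Xe.
have [pD XD Dmin] : is_lcm X (Delta M X).
  by apply: (@xgetPex _ 1 [set d | is_lcm X d]); exists (aword (delta X)).
case: lcm_delta => pd Xd dmin.
by apply: ldiv_anti; [apply: Dmin | apply: dmin].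
Qed.

(** It commutes with the generators of [X] in either case of [z_std], and its conjugates are
    positive whenever those of [z_std] are. *)
Definition delta2 X : G := aword (delta X) ^+ 2.

Lemma delta2E X : delta2 X = aword (delta X ++ delta X).
Proof. by rewrite aword_cat. Qed.

Lemma positive_delta2 X g : positive (z_std M X ^ g) -> positive (delta2 X ^ g).
Proof.
rewrite /z_std; case: ifP => _; rewrite Delta_delta // => pz.
by rewrite /delta2 conjXg; apply: positiveM.
Qed.

Lemma positive_z_std X : positive (z_std M X).
Proof.
rewrite /z_std Delta_delta; case: ifP => _; first exact: positive_aword.
by apply: positiveM; apply: positive_aword.
Qed.

Lemma delta2_gen X s : s \in X -> commute (delta2 X) (artin_gen M s).
Proof.
move=> sX; rewrite delta2E; have := aword_meq (@delta2_comm _ _ Mfin X [:: s] _).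
by rewrite aword_cat [RHS]aword_cat; apply=> t; rewrite inE => /eqP ->.
Qed.

Lemma std_parabolic_gen X s : s \in X -> std_parabolic X (artin_gen M s).
Proof. by move=> sX; apply: gen_subgroup_gen; exists s. Qed.

Lemma conj_std_parabolic X (Y : {set V}) g :
  (forall s, s \in X -> exists2 t, t \in Y & artin_gen M s ^ g = artin_gen M t) ->
  (forall t, t \in Y -> exists2 s, s \in X & artin_gen M s ^ g = artin_gen M t) ->
  conj_set g^-1 (std_parabolic X) = std_parabolic Y.
Proof.
move=> XY YX; rewrite conj_setVE; apply/seteqP; split=> [_ [a Xa <-]|b Yb].
  move: a Xa; apply: gen_subgroup_conj => _ [s /= sX <-].
  by have [t tY ->] := XY s sX; apply: std_parabolic_gen.
exists (b ^ g^-1); last by rewrite -conjgM mulVg conjg1.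
move: b Yb; apply: gen_subgroup_conj => _ [t /= tY <-].
have [s sX <-] := YX t tY; rewrite -conjgM mulgV conjg1; exact: std_parabolic_gen.
Qed.

Lemma conj_std_parabolic_gen X s : s \in X ->
  conj_set (artin_gen M s)^-1 (std_parabolic X) = std_parabolic X.
Proof.
move=> sX; have [X1 Xdiv] := gen_subgroup_closed [set artin_gen M t | t in [set` X]].
have XM := group_closedM (conj X1 Xdiv); have XV := group_closedV (conj X1 Xdiv).
have /mem_set sX' := std_parabolic_gen sX.
rewrite conj_setVE; apply/seteqP; split=> [_ [a /mem_set Xa <-]|a /mem_set Xa].
  by apply/set_mem; rewrite conjgE; apply: (XM); [apply: XV | apply: XM].
exists (a ^ (artin_gen M s)^-1); last by rewrite -conjgM mulVg conjg1.
by apply/set_mem; rewrite conjgE invgK; apply: (XM) => //; apply: (XM) => //; apply: XV.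
Qed.

(* The conjugator only matters up to its first simple factor [w]: greediness
   turns [w <= delta_X^2 w] into [w <= delta_X w] inside the Coxeter group,
   where the word from [w] to [delta_X w] cannot leave the coset [W_X w]. *)
Lemma conj_simple_part X u : lred X (simple_part Mfin u) ->
  positive (delta2 X ^ aword u) ->
  forall s, s \in X -> exists t, cgen s * simple_part Mfin u = simple_part Mfin u * cgen t.
Proof.
set w := simple_part Mfin u => wX pos.
have lw : rdm (longest X) w by apply: rdm_lred wX; apply: inW_longest.
(* This is the simple part of [delta X ++ delta X ++ u]: the inner [delta X] absorbs all of [w]. *)
have wllw : prefix_of w (longest X * greedy Mfin (longest X) (longest X * w)).
  have : ldiv (simple w) (delta2 X * aword u).
    by apply: ldiv_trans (proj2 (ldiv_conj _ _) pos); apply/ldiv_aword/prefix_of_refl.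
  rewrite delta2E -aword_cat -catA => /ldiv_aword; rewrite !simple_part_redl -/w.
  suff -> : greedy Mfin (longest X) w = w by [].
  by apply: greedy_eq => //; apply: prefix_of_refl.
set p := greedy Mfin _ _ in wllw.
have lp : rdm (longest X) p by apply: greedy_rdm.
(* A descent of [p] in [X] would cancel against [longest X]. So [p] is a minimal representative and
   a prefix of [w] itself. *)
have pX : lred X p.
  move=> s sX; case: (rdm_or_prefix s p) => // sp.
  by have := rdm_longest_gen sX (rdm_prefix lp sp).
have pw : prefix_of p w by apply: (prefix_lred (inW_longest Mfin X) pX wX); apply: greedy_prefix.
have wlw : prefix_of w (longest X * w) by apply: prefix_of_trans wllw _; apply: prefix_mul2l.
case/prefix_ofP: wlw => x wx E; rewrite -[x]cword_red in wx E.
(* [xs] spells [longest X]; comparing lengths makes it reduced, and by Matsumoto's theorem it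
   contains every letter of [X]. *)
have [xs [xsX Exs sz rib]] := ribbon wX (inW_longest Mfin X) (red_reduced x) wx (esym E).
have rxs : reduced M xs.
  rewrite /reduced Exs sz; apply/eqP; have /rdmP := wx; rewrite -E; have /rdmP -> := lw.
  by rewrite cword_red size_red addnC => /addnI ->.
move=> s sX; apply: rib; rewrite (@meq_mem _ M _ (delta X)).
  by rewrite (meq_mem (delta_first Mfin sX)) mem_head.
by apply: matsumoto => //; [apply: red_reduced | rewrite cword_red].
Qed.

(** Conjugation by [w] preserves lengths on the subgroup of [X], so the image of [longest X] has
    every generator of [Y] as a left descent. *)
Lemma conj_longest X (Y : {set V}) w : lred X w ->
  (forall s, s \in X -> exists2 t, t \in Y & cgen s * w = w * cgen t) ->
  (forall t, t \in Y -> exists2 s, s \in X & cgen s * w = w * cgen t) ->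
  rdm w (longest Y) /\ longest X * w = w * longest Y.
Proof.
move=> wX XY YX.
have transport (b : W) : inW X b ->
    exists b' : W, [/\ inW Y b', b * w = w * b' & len b' = len b].
  move=> /[dup] bX /inW_reduced[u [uX Eu ru]].
  have [v [vY Ev sv]] : exists v, [/\ {subset v <= Y}, b * w = w * cword v & size v = size u].
    rewrite -Eu; elim: u {ru Eu} uX => [|s u IHu] uX; first by exists [::]; rewrite mul1g mulg1.
    have [|v [vY Ev sv]] := IHu; first by move=> r ru; rewrite uX // inE ru orbT.
    have [|t tY Et] := XY s; first by rewrite uX // mem_head.
    exists (t :: v); split; rewrite /= ?sv //.
      by move=> r; rewrite inE => /orP[/eqP ->|/vY].
    by rewrite -mulgA Ev !mulgA Et.
  exists (cword v); split=> //; first by exists v.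
  have /rdmP := rdm_lred bX wX; rewrite Ev; have := lenM w (cword v).
  have := len_cword M v; rewrite sv; move: ru; rewrite /reduced Eu => /eqP ->.
  by move=> h1 h2 h3; lia_len.
have [m [mY Em lm]] := transport _ (inW_longest Mfin X).
have -> : longest Y = m.
  apply/esym/full_descents => // t tY; have [s sX Es] := YX t tY.
  have slX : inW X (cgen s * longest X) by apply: inWM; [apply: inW_gen | apply: inW_longest].
  have [m' [_ Em' lm']] := transport _ slX.
  have {}Em' : m' = cgen t * m.
    by apply: (mulgI w); rewrite -Em' -mulgA Em !mulgA Es.
  have /prefix_cgen := prefix_longest Mfin (inW_gen M sX).
  case: (rdm_or_prefix t m) => // /rdmP; rewrite -Em' lm' lm len_cgen => h1 h2.
  by exfalso; lia_len.
split=> //; apply/rdmP; rewrite -Em lm; have /rdmP -> := rdm_lred (inW_longest Mfin X) wX.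
by rewrite addnC.
Qed.

(** Induction on [adeg g]: each round removes a generator of [X], or the whole simple part while
    replacing [X] by [Y]. *)
Lemma positive_conj_std_parabolic X g : positive g -> positive (delta2 X ^ g) ->
  is_std_parabolic (conj_set g^-1 (std_parabolic X)).
Proof.
have [n] := ubnP (adeg g); elim: n X g => // n IHn X g gn pg pos.
have [[s sX [h ph Eg]]|nX] := pselect (exists2 s, s \in X & ldiv (artin_gen M s) g).
  rewrite Eg invgM conj_setM conj_std_parabolic_gen //; apply: IHn => //.
    by move: gn; rewrite Eg adegM ?(adeg_aword [:: s]) //; apply: positive_gen.
  have E : delta2 X ^ artin_gen M s = delta2 X by rewrite conjgE (delta2_gen sX) mulKg.
  by move: pos; rewrite Eg conjgM E.
case/positiveP: pg gn pos nX => u -> un pos nX; set w := simple_part Mfin u.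
have wX : lred X w.
  move=> s sX; case: (rdm_or_prefix s w) => // sw; case: nX; exists s => //.
  by rewrite -simple_gen; apply/ldiv_aword.
have XV := conj_simple_part wX pos.
pose Y : {set V} := [set t | `[< exists2 s, s \in X & cgen s * w = w * cgen t >]]%SET.
have YX t : t \in Y -> exists2 s, s \in X & cgen s * w = w * cgen t.
  by rewrite inE => /asboolP.
have XY s : s \in X -> exists2 t, t \in Y & cgen s * w = w * cgen t.
  by move=> sX; have [t Et] := XV s sX; exists t => //; rewrite inE; apply/asboolP; exists s.
have genE s t : s \in X -> cgen s * w = w * cgen t ->
    artin_gen M s ^ simple w = artin_gen M t.
  move=> sX E; rewrite conjgE -!simple_gen -simpleM ?wX // E simpleM ?mulKg //.
  by apply/rdmP; rewrite -E; have /rdmP -> := wX s sX; rewrite !len_cgen addnC.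
have EXY : conj_set (simple w)^-1 (std_parabolic X) = std_parabolic Y.
  apply: conj_std_parabolic => [s sX|t tY].
    by have [t tY /(genE _ _ sX)] := XY s sX; exists t.
  by have [s sX /(genE _ _ sX)] := YX t tY; exists s.
have [wY lwY] := conj_longest wX XY YX.
have deltaE : aword (delta X) ^ simple w = aword (delta Y).
  rewrite conjgE -[aword (delta X)]/(simple (longest X)) -simpleM.
    by rewrite lwY simpleM // mulKg.
  exact: rdm_lred (inW_longest _ _) wX.
have Eu : aword u = simple w * aword (remainder Mfin u).
  by rewrite -aword_cat; apply/esym/aword_meq/simple_part_remainder.
(* The first letter of a nonempty [u] divides its simple part, so the degree drops; for empty [u]
   the conjugate is [std_parabolic X] itself. *)
have w0 : 0 < len w \/ u = [::].
  case: u @w wX {XV Y YX XY genE EXY wY lwY deltaE Eu un pos nX} => [|s u] w wX; [by right|left].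
  have : prefix_of (cgen s) w.
    apply/ldiv_aword; rewrite aword_cons simple_gen; apply: ldivM; exact: positive_aword.
  by move/prefix_len; rewrite len_cgen.
case: w0 => [w0|u0]; last first.
  exists X; rewrite u0; apply: conj_set_commute => a _.
  by apply/commute_sym; rewrite [aword [::]]/(1 : G) invg1; apply: commute1.
rewrite Eu invgM conj_setM EXY; apply: IHn; last 1 first.
- by move: pos; rewrite Eu conjgM /delta2 !conjXg deltaE.
- rewrite ltnS in un; apply: leq_trans un; rewrite Eu adegM; try exact: positive_aword.
  by rewrite [adeg (simple w)]adeg_aword size_red -[X in X < _]add0n ltn_add2r.
- exact: positive_aword.
Qed.

End ArtinGroup.

Theorem proposition4 (V : finType) (M : artin_data V)
    (Mfin : finite_type M) (Mirr : irreducible M)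
    (S : set (set (artin_group M))) (Ssimplex : Cparab_simplex S) :
  exists g : artin_group M, positive g /\
    forall P : set (artin_group M), S P ->
      is_std_parabolic (conj_set (g^-1)%g P).
Proof.
case: Ssimplex => Sfin _ Svertex Scomm.
(* The pair selected inside [z_parabolic] describes both [P] and its central element. *)
have zP P : S P -> exists h X,
    P = conj_set h (std_parabolic X) /\ z_parabolic P = h * z_std M X * h^-1.
  move=> SP; have [[h [X [_ _ EP]]] _] := Svertex P SP.
  by apply: (@xgetPex _ 1 [set z | exists h X, P = conj_set h (std_parabolic X) /\
    z = h * z_std M X * h^-1]); exists (h * z_std M X * h^-1), h, X.
have /finite_seqP[zs Ezs] : finite_set (@z_parabolic V M @` S) by apply: finite_image.
have zsP z : z \in zs -> exists2 P, S P & z_parabolic P = z.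
  by move=> zz; have : [set` zs] z by []; rewrite -Ezs.
have [||g pg gzs] := @simultaneous_positive_conjugator V M Mfin zs.
- by move=> _ _ /zsP[P SP <-] /zsP[Q SQ <-]; apply: Scomm.
- move=> _ /zsP[P SP <-]; have [h [X [_ ->]]] := zP P SP; exists h.
  by rewrite conjgE -!mulgA mulKg mulVg mulg1; apply: positive_z_std.
exists g; split=> // P SP; have [h [X [EP Ez]]] := zP P SP.
(* [h^-1 * g] conjugates [std_parabolic X] to the desired subgroup but may fail to be positive; a
   central power repairs this without changing any conjugate. *)
have [k pk] := positive_shift Mfin (h^-1 * g).
set c := garside2 Mfin ^+ k in pk.
have : is_std_parabolic (conj_set (c * (h^-1 * g))^-1 (std_parabolic X)).
  apply: positive_conj_std_parabolic => //; apply: positive_delta2.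
  rewrite garside2X_commute conj_garside2X conjgM.
  have -> : z_std M X ^ h^-1 = z_parabolic P by rewrite conjgE invgK mulgA Ez.
  apply: gzs; have : [set` zs] (z_parabolic P) by rewrite -Ezs; exists P.
  by [].
have cA (A : set (artin_group M)) : conj_set c^-1 A = A.
  apply: conj_set_commute => a _; apply: commute_sym; apply: commuteV.
  exact/commute_sym/garside2X_commute.
by rewrite invgM conj_setM cA invgM invgK conj_setM -EP.
Qed.
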